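(* Let $(M^{2n+1},\phi,\xi,\eta,g)$ be a contact metric manifold endowed with a Legendrian distribution $L$. Let $Q:=\phi L$ be the conjugate Legendrian distribution of $L$ and let $\nabla$ be the bi-Legendrian connection associated to $(L,Q)$. Then the following statements are equivalent: (i) $\nabla g=0$; (ii) $\nabla\phi=0$; (iii) $\nabla_{X}X'=-(\phi[X,\phi X'])_L$ for all $X,X'\in\Gamma(L)$, $\nabla_{Y}Y'=-(\phi[Y,\phi Y'])_Q$ for all $Y,Y'\in\Gamma(Q)$, and the tensor $h$ maps the subbundle $L$ onto $L$ and the subbundle $Q$ onto $Q$; (iv) $g$ is a bundle-like metric with respect both to the distribution $L\oplus\mathbb{R}\xi$ and to the distribution $Q\oplus\mathbb{R}\xi$. Furthermore, assuming $L$ and $Q$ integrable, (i)--(iv) are equivalent to the total geodesicity (with respect to $g$) of the Legendrian foliations defined by $L$ and $Q$.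
   Context: All manifolds are smooth and connected; $\Gamma(\cdot)$ denotes smooth sections. Convention: $2d\eta(V,W)=V(\eta(W))-W(\eta(V))-\eta([V,W])$. A contact form on $M^{2n+1}$ is a 1-form $\eta$ with $\eta\wedge(d\eta)^n\neq0$ everywhere; its Reeb vector field $\xi$ is determined by $\eta(\xi)=1$, $d\eta(\xi,\cdot)=0$; $\mathcal D=\ker\eta$. A contact metric structure $(\phi,\xi,\eta,g)$ consists of a contact form $\eta$ with Reeb field $\xi$, a Riemannian metric $g$ with $g(V,\xi)=\eta(V)$ and a $(1,1)$-tensor $\phi$ with $\phi^2=-I+\eta\otimes\xi$ and $d\eta(V,W)=g(V,\phi W)$. Set $h=\frac12\mathcal L_\xi\phi$. A Legendrian distribution is an $n$-dimensional subbundle $L\subset\mathcal D$ with $d\eta(X,X')=0$ for all $X,X'\in\Gamma(L)$; if integrable it defines a Legendrian foliation. Its conjugate $Q=\phi L$ is again Legendrian and $TM=L\oplus Q\oplus\mathbb R\xi$ orthogonally. Subscripts $L,Q,\mathcal D,\mathbb R\xi$ denote projections onto the corresponding subbundles. Bi-Legendrian connection of a pair $(L_1,L_2)$ of transversal Legendrian distributions (so $TM=L_1\oplus L_2\oplus\mathbb R\xi$): for vector fields $V,W$ let $H(V,W)\in\Gamma(\mathcal D)$ be the unique section with $d\eta(H(V,W),Z)=V(d\eta(W,Z))-d\eta(W,[V,Z])$ for all $Z\in\Gamma(\mathcal D)$. Then for $X\in\Gamma(L_1)$, $Y\in\Gamma(L_2)$, $f\in C^\infty(M)$ and any vector field $W$,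 $\nabla_WX=H(W_{L_1},X)_{L_1}+[W_{L_2},X]_{L_1}+[W_{\mathbb R\xi},X]_{L_1}$, $\nabla_WY=H(W_{L_2},Y)_{L_2}+[W_{L_1},Y]_{L_2}+[W_{\mathbb R\xi},Y]_{L_2}$, $\nabla_W(f\xi)=W(f)\xi$. It preserves $L_1,L_2,\mathbb R\xi$, satisfies $\nabla d\eta=0$, $\nabla\xi=0$, and its torsion satisfies $T(X,Y)=2d\eta(X,Y)\xi$ for $X\in\Gamma(L_1),Y\in\Gamma(L_2)$ and $T(V,\xi)=[\xi,V_{L_1}]_{L_2}+[\xi,V_{L_2}]_{L_1}$ for all $V$. A metric $g$ is bundle-like with respect to a (not necessarily integrable) distribution $E$ if $(\mathcal L_Vg)(Z,Z')=0$ for all $V\in\Gamma(E)$ and all sections $Z,Z'$ of the $g$-orthogonal complement of $E$.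
   Formalization: In (iii), ''h maps L onto L and Q onto Q'' is taken as h(L) contained in L and h(Q) contained in Q, because literal surjectivity fails, for example on the standard Sasakian R^3, where h = 0 although (i), (ii) and (iv) hold for L = span(d/dy). *)

(* Defs.v *)
From HB Require Import structures.
From mathcomp Require Import all_boot all_order all_algebra perm.
From mathcomp Require Import mathcomp_extra boolp classical_sets functions reals.
From mathcomp Require Import topology normedtype landau derive.

Set Implicit Arguments.
Unset Strict Implicit.
Unset Printing Implicit Defensive.

Import Order.TTheory GRing.Theory Num.Theory.
Import numFieldNormedType.Exports.

Local Open Scope classical_set_scope.
Local Open Scope ring_scope.

Section Cn.
Context {R : realType} {m : nat}.
Implicit Types (U : set 'rV[R]_m) (f g : 'rV[R]_m -> R).

(* Meaningful for open [U] only; the values of [f] outside [U] play no role. *)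
Fixpoint Cn_on (k : nat) U f : Prop :=
  if k is k'.+1 then
    (forall x, U x -> differentiable f x) /\ (forall v, Cn_on k' U ('D_v f))
  else forall x, U x -> {for x, continuous f}.

Definition smooth_on U f : Prop := forall k, Cn_on k U f.

Definition smooth_on_rV (d : nat) U (F : 'rV[R]_m -> 'rV[R]_d) : Prop :=
  forall i, smooth_on U (fun x => F x 0 i).

Lemma smooth_on_differentiable U f x :
  smooth_on U f -> U x -> differentiable f x.
Proof. by move=> /(_ 1%N)[h _]; exact: h. Qed.

Lemma smooth_on_derive U f v : smooth_on U f -> smooth_on U ('D_v f).
Proof. by move=> sf k; have [_] := sf k.+1; exact. Qed.

Lemma Cn_onW k U f : Cn_on k.+1 U f -> Cn_on k U f.
Proof.
elim: k f => [|k IH] f [df dk].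
  by move=> x Ux; apply: differentiable_continuous; exact: df.
by split => // v; exact: IH.
Qed.

Lemma near_eq_differentiable f g (x : 'rV[R]_m) :
  (\forall y \near x, f y = g y) -> differentiable f x -> differentiable g x.
Proof.
move=> fg df.
have /diff_locallyP[cf hf] := df.
have e : g \o shift x = cst (g x) + 'd f x +o_ (0 : 'rV[R]_m) id.
  apply/eqaddoP => eps eps0.
  move/eqaddoP : hf => /(_ eps eps0) hf.
  have fg0 : \forall y \near (0 : 'rV[R]_m), f (y + x) = g (y + x).
    by move: fg; rewrite (near_shift 0) /=; apply: filterS => y; rewrite subr0.
  near=> y.
  have -> : (g \o shift x - (cst (g x) + 'd f x)) y =
            (f \o shift x - (cst (f x) + 'd f x)) y.
    rewrite /= !fctE /= (nbhs_singleton fg); congr (_ - _).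
    by rewrite /shift /=; apply/esym; near: y.
  by near: y.
have dd := diff_unique cf e.
by apply/diff_locallyP; rewrite dd.
Unshelve. all: by end_near. Qed.

Lemma open_near U x (P : 'rV[R]_m -> Prop) :
  open U -> U x -> (forall y, U y -> P y) -> \forall y \near x, P y.
Proof.
by move=> oU Ux UP; apply: (@filterS _ _ _ U) => //; exact: open_nbhs_nbhs.
Qed.

Lemma Cn_on_local k U f :
  (forall x, U x -> exists V g, [/\ open V, V x, V `<=` U, Cn_on k V g &
     forall y, V y -> f y = g y]) -> Cn_on k U f.
Proof.
elim: k f => [|k IH] f h.
  move=> x Ux; have [V [g [oV Vx VU cg fg]]] := h _ Ux.
  rewrite /prop_for /continuous_at fg //.
  have gf : {near x, g =1 f}.
    by apply: (open_near (P := fun y => g y = f y) oV Vx) => y /fg.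
  by apply: cvg_trans (cg _ Vx); exact: near_eq_cvg gf.
split=> [x Ux|v].
  have [V [g [oV Vx VU [dg _] fg]]] := h _ Ux.
  apply: near_eq_differentiable (dg _ Vx).
  by apply: (open_near (P := fun y => g y = f y) oV Vx) => y /fg.
apply: IH => x Ux; have [V [g [oV Vx VU [_ dg] fg]]] := h _ Ux.
exists V, ('D_v g); split=> // [|y Vy]; first exact: dg.
apply: near_eq_derive.
by apply: (open_near (P := fun y => f y = g y) oV Vy) => z /fg.
Qed.

Lemma Cn_on_sub k U V f : V `<=` U -> Cn_on k U f -> Cn_on k V f.
Proof.
move=> VU; elim: k f => [|k IH] f; first by move=> cf x /VU; exact: cf.
by move=> [df dk]; split=> [x /VU /df //|v]; exact/IH/dk.
Qed.

Lemma smooth_on_sub U V f : V `<=` U -> smooth_on U f -> smooth_on V f.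
Proof. by move=> VU sf k; exact: Cn_on_sub VU (sf k). Qed.

Lemma smooth_on_local U f :
  (forall x, U x -> exists V g, [/\ open V, V x, V `<=` U, smooth_on V g &
     forall y, V y -> f y = g y]) -> smooth_on U f.
Proof.
move=> h k; apply: Cn_on_local => x /h[V [g [oV Vx VU sg fg]]].
by exists V, g; split.
Qed.

Lemma eq_Cn_on k U f g : open U -> (forall x, U x -> f x = g x) ->
  Cn_on k U g -> Cn_on k U f.
Proof.
by move=> oU fg cg; apply: Cn_on_local => x Ux; exists U, g; split.
Qed.

Lemma eq_smooth_on U f g : open U -> (forall x, U x -> f x = g x) ->
  smooth_on U g -> smooth_on U f.
Proof. by move=> oU fg sg k; exact: eq_Cn_on oU fg (sg k). Qed.

Lemma smooth_on_cst U (c : R) : smooth_on U (cst c).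
Proof.
move=> k; elim: k c => [|k IH] c; first by move=> x _; exact: cst_continuous.
split=> [x _|v]; first exact: differentiable_cst.
by rewrite (_ : 'D_v _ = cst 0)//; apply/funext => x; exact: derive_cst.
Qed.

Lemma Cn_onD k U f g : open U -> Cn_on k U f -> Cn_on k U g ->
  Cn_on k U (f \+ g).
Proof.
move=> oU; elim: k f g => [|k IH] f g.
  by move=> cf cg x Ux; apply: continuousD; [exact: cf|exact: cg].
move=> [df dkf] [dg dkg]; split=> [x Ux|v].
  by apply: differentiableD; [exact: df|exact: dg].
apply: eq_Cn_on (IH _ _ (dkf v) (dkg v)) => // x Ux.
by apply: deriveD; apply: diff_derivable; [exact: df|exact: dg].
Qed.

Lemma Cn_onM k U f g : open U -> Cn_on k U f -> Cn_on k U g ->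
  Cn_on k U (f \* g).
Proof.
move=> oU; elim: k f g => [|k IH] f g.
  by move=> cf cg x Ux; apply: continuousM; [exact: cf|exact: cg].
move=> cf cg; have [df dkf] := cf; have [dg dkg] := cg; split=> [x Ux|v].
  by apply: differentiableM; [exact: df|exact: dg].
apply: (@eq_Cn_on _ _ _ ((f \* 'D_v g) \+ (g \* 'D_v f))) => //.
  move=> x Ux; have dfx : derivable f x v by apply: diff_derivable; exact: df.
  have dgx : derivable g x v by apply: diff_derivable; exact: dg.
  exact: deriveM dfx dgx.
apply: Cn_onD => //; apply: IH;
  by [exact: Cn_onW | exact: dkf | exact: dkg].
Qed.

Lemma smooth_onD U f g : open U -> smooth_on U f -> smooth_on U g ->
  smooth_on U (f \+ g).
Proof. by move=> oU sf sg k; exact: Cn_onD. Qed.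

Lemma smooth_onM U f g : open U -> smooth_on U f -> smooth_on U g ->
  smooth_on U (f \* g).
Proof. by move=> oU sf sg k; exact: Cn_onM. Qed.

Lemma smooth_onN U f : open U -> smooth_on U f -> smooth_on U (\- f).
Proof.
move=> oU sf; have := smooth_onM oU (smooth_on_cst U (-1)) sf.
by apply: eq_smooth_on => // x _ /=; rewrite mulN1r.
Qed.

Lemma smooth_on_sum (I : finType) U (F : I -> 'rV[R]_m -> R) : open U ->
  (forall i, smooth_on U (F i)) -> smooth_on U (fun x => \sum_i F i x).
Proof.
move=> oU sF; rewrite -fct_sumE.
elim/big_ind : _ => // [|f g]; [exact: smooth_on_cst|exact: smooth_onD].
Qed.

Lemma derive_dirE f x (a : 'rV[R]_m) : differentiable f x ->
  'D_a f x = \sum_i a 0 i * 'D_(delta_mx 0 i) f x.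
Proof.
move=> df; rewrite deriveE // [in LHS](row_sum_delta a) linear_sum.
by apply: eq_bigr => i _; rewrite linearZ deriveE.
Qed.

Lemma smooth_on_dir U f (a : 'rV[R]_m -> 'rV[R]_m) : open U ->
  smooth_on_rV U a -> smooth_on U f -> smooth_on U (fun x => 'D_(a x) f x).
Proof.
move=> oU sa sf.
apply: (@eq_smooth_on _ _
  (fun x => \sum_i a x 0 i * 'D_(delta_mx 0 i) f x)) => //.
  by move=> x Ux; apply: derive_dirE; exact: smooth_on_differentiable Ux.
apply: smooth_on_sum => // i; apply: smooth_onM => //.
exact: smooth_on_derive.
Qed.

(* Schwarz's theorem. *)
Lemma deriveC U f x (v w : 'rV[R]_m) : open U -> smooth_on U f -> U x ->
  'D_w ('D_v f) x = 'D_v ('D_w f) x.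
Proof.
move=> oU sf Ux.
(* mean value theorem along the direction [u] *)
have mvt h (u y : 'rV[R]_m) (s : R) : 0 < s ->
    (forall t, t \in `[0, s] -> differentiable h (y + t *: u)) ->
    exists2 t, t \in `]0, s[ & h (y + s *: u) - h y = s * 'D_u h (y + t *: u).
  move=> s0 dh; pose p t := y + t *: u.
  have dp (t : R) : is_diff t p ( *:%R^~ u).
    have : is_diff t (cst y + *:%R^~ u) (0 + *:%R^~ u) by exact: is_diffD.
    by rewrite add0r.
  have dhp t : t \in `[0, s] -> differentiable (h \o p) t.
    by move=> ts; apply: differentiable_comp; [exact: ex_diff|exact: dh].
  have [t ts] : exists2 t, t \in `]0, s[ &
      (h \o p) s - (h \o p) 0 = 'D_u h (p t) * (s - 0).
    apply: MVT => // [t ts|].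
      have ts' : t \in `[0, s] by apply: subset_itv_oo_cc.
      apply: DeriveDef; first exact/diff_derivable/dhp.
      rewrite deriveE; last exact: dhp.
      rewrite diff_comp; [|exact: ex_diff|exact: dh].
      by rewrite /= diff_val /= scale1r -deriveE //; exact: dh.
    apply: continuous_in_subspaceT => t; rewrite inE => ts.
    by apply: differentiable_continuous; exact: dhp.
  rewrite /= /p scale0r addr0 subr0 mulrC => e.
  by exists t.
have diff2 (v1 w1 : 'rV[R]_m) (s : R) : 0 < s ->
    (forall t r, t \in `[0, s] -> r \in `[0, s] -> U (x + t *: v1 + r *: w1)) ->
    exists t r, [/\ t \in `[0, s], r \in `[0, s] &
      f (x + s *: v1 + s *: w1) - f (x + s *: v1) - (f (x + s *: w1) - f x) =
      s * (s * 'D_w1 ('D_v1 f) (x + t *: v1 + r *: w1))].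
  move=> s0 Us.
  have z0 : 0 \in `[0, s] by rewrite in_itv/= lexx ltW.
  have zs : s \in `[0, s] by rewrite in_itv/= lexx ltW.
  have cc t : t \in `]0, s[ -> t \in `[0, s] by apply: subset_itv_oo_cc.
  pose h y := f (y + s *: w1).
  have dh y : U (y + s *: w1) -> differentiable h y.
    move=> Uy; apply: differentiable_comp; last exact: smooth_on_differentiable Uy.
    by apply: differentiableD; [exact: ex_diff|exact: differentiable_cst].
  have Dh y : 'D_v1 h y = 'D_v1 f (y + s *: w1).
    rewrite /derive; set lhs := (X in X @ _); set rhs := (X in _ = lim (X @ _)).
    suff -> : lhs = rhs by [].
    by apply/funext => t; rewrite /lhs /rhs /h /= addrA.
  have U0 t : t \in `[0, s] -> U (x + t *: v1).
    by move=> ts; have := Us t 0 ts z0; rewrite scale0r addr0.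
  have dhf t : t \in `[0, s] -> differentiable (h - f) (x + t *: v1).
    move=> ts; apply: differentiableB; first by apply: dh; exact: Us.
    by apply: smooth_on_differentiable sf _; exact: U0.
  have [t /cc ts e1] := mvt (h - f) v1 x s s0 dhf.
  have dg r : r \in `[0, s] -> differentiable ('D_v1 f) (x + t *: v1 + r *: w1).
    move=> rs; have sv1 := smooth_on_derive v1 sf.
    exact: smooth_on_differentiable sv1 (Us _ _ ts rs).
  have [r /cc rs e2] := mvt ('D_v1 f) w1 (x + t *: v1) s s0 dg.
  exists t, r; split=> //; rewrite -e2.
  transitivity ((h - f) (x + s *: v1) - (h - f) x).
    by rewrite /h !fctE; congr (_ - _).
  rewrite e1; congr (_ * _).
  rewrite deriveB ?Dh//; apply: diff_derivable.
    by apply: dh; exact: Us.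
  by apply: smooth_on_differentiable sf _; exact: U0.
have ca : {for x, continuous ('D_w ('D_v f))}.
  apply: differentiable_continuous.
  exact: smooth_on_differentiable (smooth_on_derive w (smooth_on_derive v sf)) Ux.
have cb : {for x, continuous ('D_v ('D_w f))}.
  apply: differentiable_continuous.
  exact: smooth_on_differentiable (smooth_on_derive v (smooth_on_derive w sf)) Ux.
apply/eqP; rewrite -subr_eq0 -normr_le0; apply/ler_addgt0Pr => e e0.
rewrite add0r; have e20 : 0 < e / 2 by rewrite divr_gt0.
have nU : \forall y \near x, U y by exact: open_nbhs_nbhs.
have na : \forall y \near x, `|'D_w ('D_v f) x - 'D_w ('D_v f) y| < e / 2.
  exact: cvgr_dist_lt ca _ e20.
have nb : \forall y \near x, `|'D_v ('D_w f) x - 'D_v ('D_w f) y| < e / 2.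
  exact: cvgr_dist_lt cb _ e20.
have : \forall y \near x, U y /\ (`|'D_w ('D_v f) x - 'D_w ('D_v f) y| < e / 2
    /\ `|'D_v ('D_w f) x - 'D_v ('D_w f) y| < e / 2).
  exact: (filterI nU (filterI na nb)).
move=> /nbhs_ballP[d /= d0 bd].
pose s := d / (`|v| + `|w| + 1).
have n0 : 0 < `|v| + `|w| + 1 by rewrite ltr_wpDl // addr_ge0.
have s0 : 0 < s by rewrite divr_gt0.
have bs t r : t \in `[0, s] -> r \in `[0, s] -> ball x d (x + t *: v + r *: w).
  rewrite !in_itv/= => /andP[t0 ts] /andP[r0 rs].
  rewrite -ball_normE /= -addrA opprD addNKr normrN.
  apply: (le_lt_trans (ler_normD _ _)); rewrite !normrZ !ger0_norm//.
  apply: (@le_lt_trans _ _ (s * (`|v| + `|w|))).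
    by rewrite mulrDr lerD // ler_wpM2r.
  by rewrite /s mulrAC ltr_pdivrMr // ltr_pM2l // ltrDl.
have Us t r tI rI := (bd _ (bs t r tI rI)).
have Us' t r (tI : t \in `[0, s]) (rI : r \in `[0, s]) := (Us t r tI rI).1.
have [t [r [tI rI E1]]] := diff2 v w s s0 Us'.
have Us'' t' r' : t' \in `[0, s] -> r' \in `[0, s] -> U (x + t' *: w + r' *: v).
  by move=> tI' rI'; rewrite addrAC; have [] := Us r' t' rI' tI'.
have [t' [r' [tI' rI' E2]]] := diff2 w v s s0 Us''.
have T (a b c : R) : `|a - c| < e / 2 -> `|b - c| < e / 2 -> `|a - b| <= e.
  move=> ac bc; rewrite -[a - b](subrKA c) (le_trans (ler_normD _ _)) //.
  by rewrite [e in _ <= e]splitr lerD ?ltW // distrC.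
have R4 (a b c d' : R) : a - b - (c - d') = a - c - (b - d').
  by rewrite !opprB addrCA [RHS]addrCA; congr (_ + _); exact: addrAC.
have E : 'D_w ('D_v f) (x + t *: v + r *: w) = 'D_v ('D_w f) (x + t' *: w + r' *: v).
  apply/(mulfI (lt0r_neq0 s0))/(mulfI (lt0r_neq0 s0)).
  apply: (etrans (esym E1)); apply: (etrans _ E2).
  have <- : x + s *: v + s *: w = x + s *: w + s *: v by exact: addrAC.
  exact: R4.
have [_ [l1 _]] := Us t r tI rI; have [_ [_ l2]] := Us r' t' rI' tI'.
rewrite addrAC in l2; rewrite E in l1.
exact: T l1 l2.
Qed.

Lemma derive_dir U (b : 'rV[R]_m -> 'rV[R]_m) f x (v : 'rV[R]_m) :
  open U -> U x -> smooth_on_rV U b -> smooth_on U f ->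
  'D_v (fun y => 'D_(b y) f y) x =
  'D_(b x) ('D_v f) x + 'D_(\row_i 'D_v (fun y => b y 0 i) x) f x.
Proof.
move=> oU Ux sb sf.
pose B i y := b y 0 i; pose G i := 'D_(delta_mx 0 i) f.
have sG i : smooth_on U (G i) by exact: smooth_on_derive.
have dB i : derivable (B i) x v.
  by apply: diff_derivable; exact: smooth_on_differentiable (sb i) Ux.
have dG i : derivable (G i) x v.
  by apply: diff_derivable; exact: smooth_on_differentiable (sG i) Ux.
have -> : 'D_v (fun y => 'D_(b y) f y) x = 'D_v (\sum_i (B i * G i)) x.
  apply: near_eq_derive; apply: (open_near (U := U)) => // y Uy.
  rewrite fct_sumE derive_dirE //; exact: smooth_on_differentiable sf Uy.
have -> : 'D_v (\sum_i (B i * G i)) x = \sum_i 'D_v (B i * G i) x.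
  by apply: derive_sum => i; exact: derivableM.
under eq_bigr => i _ do rewrite (deriveM (dB i) (dG i)).
rewrite big_split /=; congr (_ + _).
  rewrite [RHS]derive_dirE; last first.
    exact: smooth_on_differentiable (smooth_on_derive v sf) Ux.
  apply: eq_bigr => i _.
  have e : 'D_v (G i) x = 'D_(delta_mx 0 i) ('D_v f) x.
    exact: (@deriveC U f x (delta_mx 0 i) v oU sf Ux).
  by rewrite e.
rewrite [RHS]derive_dirE; last exact: smooth_on_differentiable sf Ux.
by apply: eq_bigr => i _; rewrite mxE mulrC.
Qed.

End Cn.

Record chart (R : realType) (m : nat) (M : topologicalType) := Chart {
  chart_dom : set M;
  chart_fun :> M -> 'rV[R]_m;
  chart_inv : 'rV[R]_m -> M;
  chart_dom_open : open chart_dom;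
  chart_cod_open : open (chart_fun @` chart_dom);
  chart_funK : forall p, chart_dom p -> chart_inv (chart_fun p) = p;
  chart_fun_continuous : forall p, chart_dom p -> {for p, continuous chart_fun};
  chart_inv_continuous : forall x, (chart_fun @` chart_dom) x ->
    {for x, continuous chart_inv}
}.

Definition chart_cod R m M (c : @chart R m M) := c @` chart_dom c.

Record manifold (R : realType) (m : nat) := Manifold {
  manifold_space :> topologicalType;
  atlas : set (chart R m manifold_space);
  manifold_hausdorff : hausdorff_space manifold_space;
  manifold_second_countable : @second_countable manifold_space;
  manifold_connected : connected [set: manifold_space];
  atlas_cover : forall p : manifold_space, exists2 c, atlas c & chart_dom c p;
  atlas_smooth : forall c c', atlas c -> atlas c' ->
    smooth_on_rV (chart_cod c `&` chart_inv c @^-1` chart_dom c')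
      (c' \o chart_inv c)
}.

Section SmoothFunctions.
Context {R : realType} {m : nat} (M : manifold R m).

Definition is_smooth (f : M -> R) : Prop :=
  forall c, atlas c -> smooth_on (chart_cod c) (f \o chart_inv c).

Definition smooth_pred : {pred M -> R} := fun f => `[< is_smooth f >].

Lemma is_smooth_cst (c : R) : is_smooth (cst c).
Proof. by move=> ? _; exact: smooth_on_cst. Qed.

Lemma smooth_subring : subring_closed smooth_pred.
Proof.
split=> [|f g /asboolP sf /asboolP sg|f g /asboolP sf /asboolP sg]; apply/asboolP.
- exact: is_smooth_cst.
- move=> c Ac; have oc : open (chart_cod c) by exact: chart_cod_open.
  by apply: (smooth_onD oc (sf _ Ac)); apply: smooth_onN => //; exact: sg.
- by move=> c Ac; apply: smooth_onM (sf _ Ac) (sg _ Ac); exact: chart_cod_open.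
Qed.

HB.instance Definition _ :=
  GRing.isSubringClosed.Build (M -> R) smooth_pred smooth_subring.

Record smoothfun := SmoothFun {
  smoothfun_val :> M -> R;
  smoothfun_in : smoothfun_val \in smooth_pred
}.

HB.instance Definition _ := [isSub for smoothfun_val].
HB.instance Definition _ := [Choice of smoothfun by <:].
HB.instance Definition _ :=
  GRing.SubChoice_isSubComPzRing.Build (M -> R) smooth_pred smoothfun
    smooth_subring.

Definition mk_smoothfun (f : M -> R) (sf : is_smooth f) : smoothfun :=
  SmoothFun (asboolT sf).

Definition cstf (c : R) : smoothfun := mk_smoothfun (is_smooth_cst c).

Lemma smoothfunP (f : smoothfun) : is_smooth f.
Proof. exact/asboolP/smoothfun_in. Qed.

End SmoothFunctions.
Arguments cstf {R m M}.

Section Tangent.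
Context {R : realType} {m : nat} {M : manifold R m}.
Implicit Types p : M.

(* Tangent vectors as directional derivatives acting on C^oo(M): in each chart
   around p, v is sum_i a_i d/dx_i at the point c p, for some a in R^m. *)
Definition is_tangent p (v : smoothfun M -> R^o) : Prop :=
  forall c, atlas c -> chart_dom c p ->
  exists a, forall f : smoothfun M, v f = 'D_a (f \o chart_inv c) (c p).

Definition tangent_pred p : {pred smoothfun M -> R^o} :=
  fun v => `[< is_tangent p v >].

Lemma smoothfun_diff (f : smoothfun M) c x : atlas c -> chart_cod c x ->
  differentiable (f \o chart_inv c) x.
Proof. by move=> Ac; apply: smooth_on_differentiable; exact: smoothfunP. Qed.

Lemma tangent_submod p : submod_closed (tangent_pred p).
Proof.
split=> [|k u v /asboolP tu /asboolP tv]; apply/asboolP.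
  by move=> c Ac cp; exists 0 => f; rewrite derive0.
move=> c Ac cp; have [a ua] := tu c Ac cp; have [b vb] := tv c Ac cp.
exists (k *: a + b) => f; have df := smoothfun_diff f Ac (imageP c cp).
by rewrite deriveE // linearP -!deriveE // -ua -vb.
Qed.

HB.instance Definition _ p :=
  GRing.isSubmodClosed.Build R (smoothfun M -> R^o) (tangent_pred p)
    (tangent_submod p).

Record tangent p := Tangent {
  tangent_val :> smoothfun M -> R^o;
  tangent_in : tangent_val \in tangent_pred p
}.

HB.instance Definition _ p := [isSub for @tangent_val p].
HB.instance Definition _ p := [Choice of tangent p by <:].
HB.instance Definition _ p := [SubChoice_isSubLmodule of tangent p by <:].

Lemma tangentP p (v : tangent p) : is_tangent p v.
Proof. exact/asboolP/tangent_in. Qed.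

Definition mk_tangent p v (tv : is_tangent p v) : tangent p :=
  Tangent (asboolT tv).

Lemma tangent_ext p (u v : tangent p) : (forall f, u f = v f) -> u = v.
Proof. by move=> uv; apply/val_inj/funext. Qed.

End Tangent.

Section VectorFields.
Context {R : realType} {m : nat} {M : manifold R m}.

(* In each chart, the components a of V can be chosen smoothly near each
   point. *)
Definition smooth_section (V : forall p : M, tangent p) : Prop :=
  forall c p, atlas c -> chart_dom c p ->
  exists (U : set 'rV[R]_m) (a : 'rV[R]_m -> 'rV[R]_m),
    [/\ open U, U (c p), U `<=` chart_cod c, smooth_on_rV U a &
      forall x, U x -> forall f,
        V (chart_inv c x) f = 'D_(a x) (f \o chart_inv c) x].

Record vfield := VField {
  vfield_val :> forall p : M, tangent p;
  vfield_smooth : smooth_section vfield_val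
}.
Implicit Types (V W : vfield) (f g : smoothfun M).

HB.instance Definition _ := gen_eqMixin vfield.
HB.instance Definition _ := gen_choiceMixin vfield.

Lemma vfield_ext V W : (forall p, V p = W p) -> V = W.
Proof.
case: V W => [V sV] [W sW] /= VW.
have e : V = W by exact: functional_extensionality_dep.
by subst W; congr VField; exact: Prop_irrelevance.
Qed.

Lemma smooth_section0 : smooth_section (fun p => 0).
Proof.
move=> c p Ac cp; exists (chart_cod c), (fun=> 0); split => //.
- exact: chart_cod_open.
- by exists p.
- by move=> i; rewrite (_ : (fun _ => _) = cst 0);
    [exact: smooth_on_cst|apply/funext => x; rewrite mxE].
- by move=> x _ f; rewrite derive0.
Qed.

Lemma smooth_section_lin f g V W :
  smooth_section (fun p => f p *: V p + g p *: W p).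
Proof.
move=> c p Ac cp.
have [U [a [oU Ux Uc sa Va]]] := vfield_smooth V Ac cp.
have [U' [b [oU' U'x U'c sb Wb]]] := vfield_smooth W Ac cp.
have oN : open (U `&` U') by exact: openI.
have sN (h : smoothfun M) : smooth_on (U `&` U') (h \o chart_inv c).
  by apply: (@smooth_on_sub _ _ (chart_cod c)) => [x []/Uc//|]; exact: smoothfunP.
exists (U `&` U'), (fun x => f (chart_inv c x) *: a x + g (chart_inv c x) *: b x).
split => //; first by move=> x [/Uc].
- move=> i; apply: (@eq_smooth_on _ _ _ _
    (((f \o chart_inv c) \* (fun x => a x 0 i)) \+
     ((g \o chart_inv c) \* (fun x => b x 0 i)))) => //.
    by move=> x _; rewrite !mxE.
  apply: smooth_onD => //; apply: smooth_onM => //.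
    by apply: smooth_on_sub (sa i) => x [].
  by apply: smooth_on_sub (sb i) => x [].
- move=> x [Ux' U'x'] h.
  have dh : differentiable (h \o chart_inv c) x.
    exact: smoothfun_diff Ac (Uc _ Ux').
  by rewrite deriveE // linearD !linearZ -!deriveE // -Va // -Wb.
Qed.

Definition vlin f g V W : vfield := VField (smooth_section_lin f g V W).
Definition vzero : vfield := VField smooth_section0.
Definition vadd V W : vfield := vlin 1 1 V W.
Definition vscale f V : vfield := vlin f 0 V V.
Definition vopp V : vfield := vscale (- 1) V.

Lemma vaddE V W p : vadd V W p = V p + W p.
Proof. by rewrite /= !scale1r. Qed.
Lemma vscaleE f V p : vscale f V p = f p *: V p.
Proof. by rewrite /= scale0r addr0. Qed.
Lemma voppE V p : vopp V p = - V p.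
Proof. by rewrite vscaleE scaleN1r. Qed.

Fact vaddA : associative vadd.
Proof. by move=> U V W; apply: vfield_ext => p; rewrite !vaddE addrA. Qed.
Fact vaddC : commutative vadd.
Proof. by move=> U V; apply: vfield_ext => p; rewrite !vaddE addrC. Qed.
Fact vadd0 : left_id vzero vadd.
Proof. by move=> U; apply: vfield_ext => p; rewrite vaddE add0r. Qed.
Fact vaddN : left_inverse vzero vopp vadd.
Proof. by move=> U; apply: vfield_ext => p; rewrite vaddE voppE addNr. Qed.

HB.instance Definition _ :=
  GRing.isZmodule.Build vfield vaddA vaddC vadd0 vaddN.

Lemma vfieldD V W p : (V + W) p = V p + W p. Proof. exact: vaddE. Qed.
Lemma vfieldN V p : (- V) p = - V p. Proof. exact: voppE. Qed.

Fact vscaleA f g V : vscale f (vscale g V) = vscale (f * g) V.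
Proof. by apply: vfield_ext => p; rewrite !vscaleE scalerA. Qed.
Fact vscale1 : left_id 1 vscale.
Proof. by move=> V; apply: vfield_ext => p; rewrite vscaleE scale1r. Qed.
Fact vscaleDr : right_distributive vscale +%R.
Proof.
by move=> f V W; apply: vfield_ext => p; rewrite !(vfieldD, vscaleE) scalerDr.
Qed.
Fact vscaleDl V : {morph vscale^~ V : f g / f + g}.
Proof.
by move=> f g; apply: vfield_ext => p; rewrite !(vfieldD, vscaleE) scalerDl.
Qed.

HB.instance Definition _ :=
  GRing.Zmodule_isLmodule.Build (smoothfun M) vfield
    vscaleA vscale1 vscaleDr vscaleDl.

Lemma vfieldZ f V p : (f *: V) p = f p *: V p. Proof. exact: vscaleE. Qed.

Lemma is_smooth_vder V f : is_smooth (fun p => V p f).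
Proof.
move=> c Ac; apply: smooth_on_local => _ [p cp <-].
have [U [a [oU Ux Uc sa Va]]] := vfield_smooth V Ac cp.
exists U, (fun x => 'D_(a x) (f \o chart_inv c) x).
split => // [|x /Va]; last exact.
apply: smooth_on_dir => //.
by apply: (@smooth_on_sub _ _ (chart_cod c)) => //; exact: smoothfunP.
Qed.

Definition vder V f : smoothfun M := mk_smoothfun (is_smooth_vder V f).

Lemma bracket_subproof V W c p : atlas c -> chart_dom c p ->
  exists (U : set 'rV[R]_m) (d : 'rV[R]_m -> 'rV[R]_m),
    [/\ open U, U (c p), U `<=` chart_cod c, smooth_on_rV U d &
      forall x, U x -> forall f,
        V (chart_inv c x) (vder W f) - W (chart_inv c x) (vder V f) =
        'D_(d x) (f \o chart_inv c) x].
Proof.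
move=> Ac cp.
have [U [a [oU Ux Uc sa Va]]] := vfield_smooth V Ac cp.
have [U' [b [oU' U'x U'c sb Wb]]] := vfield_smooth W Ac cp.
have oN : open (U `&` U') by exact: openI.
have sN (h : smoothfun M) : smooth_on (U `&` U') (h \o chart_inv c).
  by apply: (@smooth_on_sub _ _ (chart_cod c)) => [x []/Uc//|]; exact: smoothfunP.
have saN : smooth_on_rV (U `&` U') a.
  by move=> i; apply: smooth_on_sub (sa i) => x [].
have sbN : smooth_on_rV (U `&` U') b.
  by move=> i; apply: smooth_on_sub (sb i) => x [].
exists (U `&` U'), (fun x => \row_i 'D_(a x) (fun y => b y 0 i) x -
                             \row_i 'D_(b x) (fun y => a y 0 i) x).
split => //; first by move=> x [/Uc].
- move=> i; apply: (@eq_smooth_on _ _ _ _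
    ((fun x => 'D_(a x) (fun y => b y 0 i) x) \-
     (fun x => 'D_(b x) (fun y => a y 0 i) x))) => //.
    by move=> x _; rewrite !mxE.
  by apply: smooth_onD => //; [|apply: smooth_onN => //]; exact: smooth_on_dir.
- move=> x Nx f; have [Ux' U'x'] := Nx.
  rewrite Va // Wb //.
  have -> : 'D_(a x) (vder W f \o chart_inv c) x =
            'D_(a x) (fun y => 'D_(b y) (f \o chart_inv c) y) x.
    apply: near_eq_derive.
    apply: (@open_near _ _ _ x (fun y => (vder W f \o chart_inv c) y =
      'D_(b y) (f \o chart_inv c) y) oU' U'x') => y Uy.
    exact: Wb.
  have -> : 'D_(b x) (vder V f \o chart_inv c) x =
            'D_(b x) (fun y => 'D_(a y) (f \o chart_inv c) y) x.
    apply: near_eq_derive.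
    apply: (@open_near _ _ _ x (fun y => (vder V f \o chart_inv c) y =
      'D_(a y) (f \o chart_inv c) y) oU Ux') => y Uy.
    exact: Va.
  rewrite (derive_dir _ oN Nx sbN (sN f)) (derive_dir _ oN Nx saN (sN f)).
  rewrite (deriveC _ _ oN (sN f) Nx).
  rewrite opprD addrACA subrr add0r.
  have df := smoothfun_diff f Ac (Uc _ Ux').
  by rewrite !deriveE // linearB.
Qed.

End VectorFields.

Arguments vfield {R m} M.

Section Bracket.
Context {R : realType} {m : nat} {M : manifold R m}.
Implicit Types (V W : vfield M).

Lemma bracket_tangent V W p :
  is_tangent p (fun f => V p (vder W f) - W p (vder V f)).
Proof.
move=> c Ac cp.
have [U [d [_ Ux _ _ dE]]] := bracket_subproof V W Ac cp.
by exists (d (c p)) => f; have := dE _ Ux f; rewrite chart_funK.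
Qed.

Lemma bracket_smooth V W :
  smooth_section (fun p => mk_tangent (@bracket_tangent V W p)).
Proof. by move=> c p Ac cp; exact: bracket_subproof. Qed.

Definition bracket V W : vfield M := VField (bracket_smooth V W).

Lemma bracketE V W p f : bracket V W p f = V p (vder W f) - W p (vder V f).
Proof. by []. Qed.

End Bracket.

Section Tensors.
Context {R : realType} {m : nat} (M : manifold R m).

(* A pointwise (multi)linear tensor is smooth iff it takes smooth vector fields
   to smooth functions, resp. to smooth vector fields. *)

Record oneform := OneForm {
  oneform_val :> forall p : M, {scalar tangent p};
  oneform_smooth : forall V : vfield M, is_smooth (fun p => oneform_val p (V p))
}.

Record endo := Endo {
  endo_val :> forall p : M, {linear tangent p -> tangent p};
  endo_smooth : forall V : vfield M, smooth_section (fun p => endo_val p (V p))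
}.

Record metric := Metric {
  metric_val :> forall p : M, tangent p -> tangent p -> R;
  metric_sym : forall p (u v : tangent p), metric_val u v = metric_val v u;
  metric_linear : forall p (k : R) (u v w : tangent p),
    metric_val (k *: u + v) w = k * metric_val u w + metric_val v w;
  metric_pos : forall p (u : tangent p), u != 0 -> 0 < metric_val u u;
  metric_smooth : forall V W : vfield M,
    is_smooth (fun p => metric_val (V p) (W p))
}.

End Tensors.

Section RiemannContact.
Context {R : realType} {m : nat} {M : manifold R m}.
Implicit Types (eta : oneform M) (phi : endo M) (g : metric M).
Implicit Types (U V W Z xi : vfield M) (f : smoothfun M).

Definition app_form eta V : smoothfun M :=
  mk_smoothfun (oneform_smooth eta V).

Definition app_endo phi V : vfield M := VField (endo_smooth phi V).

Definition app_metric g V W : smoothfun M :=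
  mk_smoothfun (metric_smooth g V W).

(* Convention: 2 d eta (V, W) = V (eta W) - W (eta V) - eta [V, W]. *)
Definition dform eta V W : smoothfun M :=
  cstf 2^-1 * (vder V (app_form eta W) - vder W (app_form eta V)
               - app_form eta (bracket V W)).

Definition is_reeb eta xi : Prop :=
  app_form eta xi = 1 /\ forall W, dform eta xi W = 0.

(* (L_V g)(Z, Z') *)
Definition lie_metric g V Z Z' : smoothfun M :=
  vder V (app_metric g Z Z') - app_metric g (bracket V Z) Z'
  - app_metric g Z (bracket V Z').

(* h = 1/2 L_xi phi *)
Definition tensor_h phi xi V : vfield M :=
  cstf 2^-1 *: (bracket xi (app_endo phi V) - app_endo phi (bracket xi V)).

Definition is_connection (nabla : vfield M -> vfield M -> vfield M) : Prop :=
  [/\ forall f W W' V, nabla (f *: W + W') V = f *: nabla W V + nabla W' V,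
      forall W V V', nabla W (V + V') = nabla W V + nabla W V' &
      forall f W V, nabla W (f *: V) = vder W f *: V + f *: nabla W V].

Definition parallel_metric (nabla : vfield M -> vfield M -> vfield M) g : Prop :=
  forall W V V', vder W (app_metric g V V') =
    app_metric g (nabla W V) V' + app_metric g V (nabla W V').

Definition parallel_endo (nabla : vfield M -> vfield M -> vfield M) phi : Prop :=
  forall W V, nabla W (app_endo phi V) = app_endo phi (nabla W V).

Definition levi_civita g (nabla : vfield M -> vfield M -> vfield M) : Prop :=
  [/\ is_connection nabla, parallel_metric nabla g &
      forall V W, nabla V W - nabla W V = bracket V W].

Definition distribution := forall p : M, set (tangent p).
Implicit Types E F L Q : distribution.

Definition sections E : set (vfield M) :=
  [set V | forall p, E p (V p)].

(* The fields of a local frame may be taken globally defined, by multiplying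
   with a bump function. *)
Definition subbundle (k : nat) E : Prop :=
  forall p : M, exists X : 'I_k -> vfield M, \forall q \near p,
    (forall c : 'I_k -> R,
       \sum_i c i *: X i q = 0 -> forall i, c i = 0) /\
    E q = [set \sum_i c i *: X i q | c in [set: 'I_k -> R]].

(* Locally E is the kernel of d(y_1, ..., y_k), i.e. tangent to the fibres of
   the map y.  For E of corank k the y_i are then independent, so that y is
   locally a submersion and its fibres are the leaves. *)
Definition integrable (k : nat) E : Prop :=
  forall p : M, exists y : 'I_k -> smoothfun M, \forall q \near p,
    E q = [set v : tangent q | forall i, v (y i) = 0].

Definition dker eta : distribution := fun p => [set v | eta p v = 0].

Definition dline xi : distribution := fun p => [set k *: xi p | k in [set: R]].

Definition dsum E F : distribution :=
  fun p => [set u + v | u in E p & v in F p].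

Definition dimage phi E : distribution := fun p => phi p @` E p.

Definition dorth g E : distribution :=
  fun p => [set v | forall u, E p u -> g p u v = 0].

(* The component of V in Gamma(E), when TM is the direct sum of E and F; it is
   then the unique U in this set. *)
Definition proj E F V : vfield M :=
  xget 0 [set U | sections E U /\ sections F (V - U)].

(* Inclusion T E <= E, not T E = E: for T = h, which vanishes on every Sasakian
   manifold, surjectivity is not meant. *)
Definition preserves (T : vfield M -> vfield M) E : Prop :=
  forall V, sections E V -> sections E (T V).

Definition bundle_like g E : Prop :=
  forall V Z Z', sections E V ->
    sections (dorth g E) Z -> sections (dorth g E) Z' ->
    lie_metric g V Z Z' = 0.

Definition totally_geodesic (nablag : vfield M -> vfield M -> vfield M) E : Prop :=
  forall X X', sections E X -> sections E X' -> sections E (nablag X X').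

(* This determines H: the right-hand side is C^oo(M)-linear in the section Z of
   ker eta, on which d eta is nondegenerate. *)
Definition is_biLegendrian_H eta (H : vfield M -> vfield M -> vfield M) : Prop :=
  forall V W, sections (dker eta) (H V W) /\
    forall Z, sections (dker eta) Z ->
      dform eta (H V W) Z = vder V (dform eta W Z) - dform eta W (bracket V Z).

Definition biLegendrian_connection eta xi L1 L2
    (nabla : vfield M -> vfield M -> vfield M) : Prop :=
  let pr1 := proj L1 (dsum L2 (dline xi)) in
  let pr2 := proj L2 (dsum L1 (dline xi)) in
  let prx := proj (dline xi) (dsum L1 L2) in
  is_connection nabla /\
  exists2 H, is_biLegendrian_H eta H &
  [/\ forall W X, sections L1 X -> nabla W X =
        pr1 (H (pr1 W) X) + pr1 (bracket (pr2 W) X) + pr1 (bracket (prx W) X),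
      forall W Y, sections L2 Y -> nabla W Y =
        pr2 (H (pr2 W) Y) + pr2 (bracket (pr1 W) Y) + pr2 (bracket (prx W) Y) &
      forall W f, nabla W (f *: xi) = vder W f *: xi].

End RiemannContact.

Arguments distribution {R m} M.

Section Contact.
Context {R : realType} {n : nat} {M : manifold R n.*2.+1}.
Implicit Types (eta : oneform M) (phi : endo M) (g : metric M).

(* A positive multiple, depending on the normalization of the wedge product,
   of (eta /\ (d eta)^n)(V_0, ..., V_2n). *)
Definition contact_volume eta (V : 'I_n.*2.+1 -> vfield M) : smoothfun M :=
  \sum_(s : 'S_n.*2.+1) (-1) ^+ s *
    (app_form eta (V (s ord0)) *
     \prod_(i < n) dform eta (V (s (inord i.*2.+1))) (V (s (inord i.*2.+2)))).

Definition contact_form eta : Prop :=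
  forall p : M, exists V : 'I_n.*2.+1 -> vfield M, contact_volume eta V p != 0.

Definition contact_metric phi (xi : vfield M) eta g : Prop :=
  [/\ contact_form eta,
      is_reeb eta xi,
      forall V, app_metric g V xi = app_form eta V,
      forall V, app_endo phi (app_endo phi V) = - V + app_form eta V *: xi &
      forall V W, dform eta V W = app_metric g V (app_endo phi W)].

Definition legendrian eta (L : distribution M) : Prop :=
  [/\ subbundle n L,
      forall p (v : tangent p), L p v -> eta p v = 0 &
      forall X X', sections L X -> sections L X' -> dform eta X X' = 0].

End Contact.

(* Main.v *)
From HB Require Import structures.
Require Import Defs.
From mathcomp Require Import all_boot all_order all_algebra.
From mathcomp Require Import boolp classical_sets functions reals.
From mathcomp Require Import topology normedtype derive ring lra.

Set Implicit Arguments.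
Unset Strict Implicit.
Unset Printing Implicit Defensive.

Import Order.TTheory GRing.Theory Num.Theory.
Import numFieldNormedType.Exports.
Local Open Scope ring_scope.

(** Why the equivalences hold.

    The bi-Legendrian connection is determined by brackets and by [d eta].
    Across the summands [L], [Q] and [R xi] it is a projected bracket
    ([nabla_bracket]); inside [L] it is dual, under the pairing of [L] with [Q]
    by [d eta], to the projected bracket on [Q], and symmetrically inside [Q]
    ([nabla_dform_along]). Together with [L_xi (d eta) = 0] this says that
    [d eta] is parallel ([nabla_dform_eq0]). As [nabla] preserves the three
    summands and kills [xi], [eta] is parallel as well ([vder_form]).

    Now [g = eta (x) eta - d eta (., phi .)] and [d eta = g (., phi .)], so [g]
    is parallel if and only if [phi] is: (i) and (ii) are equivalent. Condition
    (iii) is [nabla phi = 0] read on each pair of summands, where all derivatives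
    are projected brackets and [phi] exchanges the two projections; the
    condition on [h] is the direction of [xi].

    For (iv), let [V] be a section of [L + R xi] and [Y, Y'] sections of [Q].
    Then [nabla_V Y] is the [Q] component of [[V, Y]], so
    [(L_V g)(Y, Y') = (nabla_V g)(Y, Y')] ([lie_nabla_metric]). Thus (iv) says
    that [nabla g] vanishes on [Q] in the directions of [L] and [xi], and on [L]
    in those of [Q] and [xi]. The missing components follow from
    [(nabla_W g)(phi X, phi X') = - (nabla_W g)(X, X')] ([nabla_metric_phi]),
    again a consequence of [nabla (d eta) = 0].

    For total geodesicity, let [D] be the Levi-Civita connection and [Z] normal
    to [L]. Then [(L_Z g)(X, X') = - g (Z, D_X X') - g (Z, D_X' X)], and the two
    terms agree when [L] is integrable. Hence [L] is totally geodesic exactly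
    when [g] is bundle-like for [Q + R xi], and symmetrically for [Q].

    All of this needs the splitting [TM = L + Q + R xi] by smooth global fields.
    Orthogonal projection onto a subbundle is smooth by Cramer's rule for a Gram
    matrix ([orthogonal_projection]). Projecting [V] and [phi V] onto [L] gives
    the [L] component of [V] and, after applying [- phi], its [Q] component;
    nothing but a multiple of [xi] is left over, for reasons of dimension
    ([legendrian_maximal], [legendrian_splitting]). *)

(** * Smoothness of reciprocals *)

Section Reciprocal.
Context {R : realType} {m : nat}.
Implicit Types (U : set 'rV[R]_m) (f : 'rV[R]_m -> R).

(** Induction on the order of differentiability: the derivative of [1/f] is
    [- f' / f^2], which involves [1/f] at one order less. *)
Lemma Cn_onV k U f : open U -> (forall x, U x -> f x != 0) ->
  Cn_on k U f -> Cn_on k U (fun x => (f x)^-1).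
Proof.
move=> oU f0; elim: k f f0 => [|k IH] f f0.
  by move=> cf x Ux; apply: continuousV; [exact: f0|exact: cf].
move=> cf; have [df dkf] := cf; split=> [x Ux|v].
  by apply: differentiableV; [exact: df|exact: f0].
have iv : Cn_on k U (fun x => (f x)^-1) by apply: IH => //; exact: Cn_onW.
apply: (@eq_Cn_on _ _ _ _ _
  (\- ((fun x => (f x)^-1) \* ((fun x => (f x)^-1) \* 'D_v f)))) => //.
  move=> x Ux; rewrite deriveV; [|exact: f0|by apply: diff_derivable; exact: df].
  by rewrite /= scaleNr expr2 invfM mulrA.
have := Cn_onM oU (@smooth_on_cst _ _ U (-1) k)
  (Cn_onM oU iv (Cn_onM oU iv (dkf v))).
by apply: eq_Cn_on => // x _ /=; rewrite mulN1r.
Qed.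

End Reciprocal.

(** * Derivations, brackets and locality *)

Section Calculus.
Context {R : realType} {m : nat} {M : manifold R m}.
Implicit Types (V W X Y Z : vfield M) (f h : smoothfun M) (p : M).

Lemma smoothfun_ext f h : (forall p, f p = h p) -> f = h.
Proof. by move=> fh; apply/val_inj/funext. Qed.

Lemma smoothfun_at p f h : f = h -> f p = h p.
Proof. by move=> ->. Qed.

Lemma half_double f : cstf 2^-1 * (f + f) = f.
Proof.
apply: smoothfun_ext => p; change (2^-1 * (f p + f p) = f p); lra.
Qed.

Lemma near_chart c p (P : M -> Prop) : atlas c -> chart_dom c p ->
  (\forall q \near p, P q) -> \forall x \near c p, P (chart_inv c x).
Proof.
move=> Ac cp nP.
have := chart_inv_continuous (c := c) (imageP c cp).
by rewrite /prop_for /continuous_at chart_funK //; apply.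
Qed.

(** A tangent vector is a directional derivative in a chart, hence sees only the
    germ of a function. *)
Lemma tangent_local p (v : tangent p) f h :
  (\forall q \near p, f q = h q) -> v f = v h.
Proof.
move=> fh; have [c Ac cp] := atlas_cover p.
have [a va] := tangentP v Ac cp; rewrite !va.
apply: near_eq_derive.
exact: (near_chart Ac cp (P := fun q => f q = h q)).
Qed.

Lemma tangentD p (v : tangent p) f h : v (f + h) = v f + v h.
Proof.
have [c Ac cp] := atlas_cover p; have [a va] := tangentP v Ac cp; rewrite !va.
have d (k : smoothfun M) : derivable (k \o chart_inv c) (c p) a.
  by apply: diff_derivable; apply: smoothfun_diff => //; exists p.
exact: deriveD (d f) (d h).
Qed.

Lemma tangentM p (v : tangent p) f h : v (f * h) = f p * v h + h p * v f.
Proof.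
have [c Ac cp] := atlas_cover p; have [a va] := tangentP v Ac cp; rewrite !va.
have d (k : smoothfun M) : derivable (k \o chart_inv c) (c p) a.
  by apply: diff_derivable; apply: smoothfun_diff => //; exists p.
have := deriveM (d f) (d h); rewrite /= chart_funK //; exact.
Qed.

Lemma tangent_cst p (v : tangent p) k : v (cstf k) = 0.
Proof.
have [c Ac cp] := atlas_cover p; have [a ->] := tangentP v Ac cp.
exact: derive_cst.
Qed.

Lemma vderD V f h : vder V (f + h) = vder V f + vder V h.
Proof. by apply: smoothfun_ext => p; exact: tangentD. Qed.

Lemma vderM V f h : vder V (f * h) = f * vder V h + h * vder V f.
Proof. by apply: smoothfun_ext => p; exact: tangentM. Qed.

Lemma vder_cst V k : vder V (cstf k) = 0.
Proof. by apply: smoothfun_ext => p; exact: tangent_cst. Qed.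

Lemma vder0 V : vder V 0 = 0.
Proof. by apply: (addrI (vder V 0)); rewrite -vderD !addr0. Qed.

Lemma vderN V f : vder V (- f) = - vder V f.
Proof. by apply/eqP; rewrite -addr_eq0 -vderD addNr vder0. Qed.

Lemma vder1 V : vder V 1 = 0.
Proof.
by rewrite (_ : 1 = cstf 1) ?vder_cst //; exact: smoothfun_ext.
Qed.

Lemma vderDv V W f : vder (V + W) f = vder V f + vder W f.
Proof. by apply: smoothfun_ext => p; rewrite -[RHS]/((V p + W p) f) -vfieldD. Qed.

Lemma vderZv f V h : vder (f *: V) h = f * vder V h.
Proof.
by apply: smoothfun_ext => p; rewrite -[RHS]/((f p *: V p) h) -vfieldZ.
Qed.

Lemma vder0v f : vder 0 f = 0.
Proof. by rewrite -(scale0r 0) vderZv mul0r. Qed.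

Lemma vderNv V f : vder (- V) f = - vder V f.
Proof. by rewrite -scaleN1r vderZv mulN1r. Qed.

(** Identities between brackets, such as Jacobi's, become ring identities once
    both sides are applied to a function. *)
Lemma vfield_eqP V W : (forall f, vder V f = vder W f) -> V = W.
Proof.
move=> VW; apply: vfield_ext => p; apply: tangent_ext => f.
by have /(congr1 (fun k : smoothfun M => k p)) := VW f.
Qed.

Lemma vder_bracket V W f :
  vder (bracket V W) f = vder V (vder W f) - vder W (vder V f).
Proof. exact: smoothfun_ext. Qed.

Definition vderE := (vder_bracket, vderD, vderM, vderN, vder0, vderDv, vderZv,
  vderNv, vder0v).

Lemma bracketC V W : bracket V W = - bracket W V.
Proof. by apply: vfield_eqP => f; rewrite !vderE; ring. Qed.

Lemma bracketDl V W X : bracket (V + W) X = bracket V X + bracket W X.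
Proof. by apply: vfield_eqP => f; rewrite !vderE; ring. Qed.

Lemma bracket0l W : bracket 0 W = 0.
Proof. by apply: vfield_eqP => f; rewrite !vderE; ring. Qed.

Lemma bracketNr V W : bracket V (- W) = - bracket V W.
Proof. by apply: vfield_eqP => h; rewrite !vderE; ring. Qed.

Lemma jacobi V W X :
  bracket V (bracket W X) = bracket (bracket V W) X + bracket W (bracket V X).
Proof. by apply: vfield_eqP => f; rewrite !vderE; ring. Qed.

End Calculus.

(** * Orthogonal projection onto a subbundle *)

Section Projection.
Context {R : realType} {m : nat} {M : manifold R m} (g : metric M).
Implicit Types (V W : vfield M) (f h : smoothfun M) (p q : M).
Implicit Types (E F : distribution M).

Lemma metricC p (u v : tangent p) : g p u v = g p v u.
Proof. exact: Defs.metric_sym. Qed.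

Lemma metricDl p (u v w : tangent p) : g p (u + v) w = g p u w + g p v w.
Proof. by have := metric_linear g 1 u v w; rewrite scale1r mul1r. Qed.

Lemma metric0l p (w : tangent p) : g p 0 w = 0.
Proof. by apply: (addrI (g p 0 w)); rewrite -metricDl !addr0. Qed.

Lemma metricZl p k (u w : tangent p) : g p (k *: u) w = k * g p u w.
Proof. by rewrite -[k *: u]addr0 metric_linear metric0l addr0. Qed.

Lemma metricNl p (u w : tangent p) : g p (- u) w = - g p u w.
Proof. by rewrite -scaleN1r metricZl mulN1r. Qed.

Lemma metricDr p (u v w : tangent p) : g p w (u + v) = g p w u + g p w v.
Proof. by rewrite metricC metricDl !(metricC w). Qed.

Lemma metricZr p k (u w : tangent p) : g p w (k *: u) = k * g p w u.
Proof. by rewrite metricC metricZl (metricC w). Qed.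

Lemma metricNr p (u w : tangent p) : g p w (- u) = - g p w u.
Proof. by rewrite metricC metricNl (metricC w). Qed.

Lemma metric0r p (w : tangent p) : g p w 0 = 0.
Proof. by rewrite metricC metric0l. Qed.

Lemma metric_suml p (I : finType) (u : I -> tangent p) w :
  g p (\sum_i u i) w = \sum_i g p (u i) w.
Proof.
apply: (big_morph (fun u => g p u w)) => [u' v|].
  exact: metricDl.
exact: metric0l.
Qed.

Lemma metric_eq0 p (u : tangent p) : g p u u = 0 -> u = 0.
Proof.
move=> guu; apply/eqP; apply: contraT => /(metric_pos g).
by rewrite guu ltxx.
Qed.

Lemma vfield_sumE p (I : finType) (W : I -> vfield M) :
  (\sum_i W i) p = \sum_i W i p.
Proof.
by apply: (big_morph (fun W : vfield M => W p)) => // u v; exact: vfieldD.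
Qed.

Definition value_at q (f : smoothfun M) : R := f q.

Fact value_at_additive q : zmod_morphism (value_at q).
Proof. by []. Qed.
Fact value_at_multiplicative q : monoid_morphism (value_at q).
Proof. by []. Qed.
HB.instance Definition _ q :=
  GRing.isZmodMorphism.Build _ _ (value_at q) (value_at_additive q).
HB.instance Definition _ q :=
  GRing.isMonoidMorphism.Build _ _ (value_at q) (value_at_multiplicative q).

Definition independent_at k (X : 'I_k -> vfield M) q :=
  forall c : 'I_k -> R, \sum_i c i *: X i q = 0 -> forall i, c i = 0.

(** Cramer's rule for the projection onto the span of [X]: [d] is the
    determinant of the Gram matrix and [W] is [d] times the projection of [V].
    Without the division by [d] both are global and smooth, also where [X] is
    not a frame. *)
Lemma gram_cramer k (X : 'I_k -> vfield M) V :
  exists (d : smoothfun M) (W : vfield M), forall q, independent_at X q ->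
    [/\ d q != 0,
        exists c : 'I_k -> R, W q = \sum_i c i *: X i q &
        forall j, g q (W q) (X j q) = d q * g q (V q) (X j q)].
Proof.
pose G : 'M[smoothfun M]_k := \matrix_(i, j) app_metric g (X i) (X j).
pose b : 'rV[smoothfun M]_k := \row_j app_metric g V (X j).
pose c := b *m \adj G.
exists (\det G), (\sum_i c 0 i *: X i) => q indep; split.
(* A kernel vector of the Gram matrix gives a combination of [X] of length 0. *)
- change (value_at q (\det G) != 0); rewrite -det_map_mx.
  apply/det0P => -[v v0 vG].
  case/eqP: v0; apply/rowP => i; rewrite mxE; apply: (indep (v 0)).
  apply: metric_eq0; rewrite metric_suml big1 // => j _.
  rewrite metricZl metricC metric_suml.
  have /rowP/(_ j) := vG; rewrite !mxE => vGj.
  rewrite (_ : \sum_i0 _ = 0) ?mulr0 // -[RHS]vGj.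
  by apply: eq_bigr => l _; rewrite metricZl !mxE.
- exists (fun i => c 0 i q); rewrite vfield_sumE.
  by apply: eq_bigr => i _; rewrite vfieldZ.
- move=> j; have cG : c *m G = \det G *: b.
    by rewrite -mulmxA mul_adj_mx mul_mx_scalar.
  have /rowP/(_ j) := cG; rewrite !mxE => /(congr1 (value_at q)).
  rewrite rmorph_sum rmorphM /= => <-.
  rewrite vfield_sumE metric_suml; apply: eq_bigr => i _.
  by rewrite vfieldZ metricZl !mxE.
Qed.

(** The form in which Cramer's rule proves smoothness: locally the family is a
    global field divided by a global function. *)
Lemma smooth_section_quotient (S : forall p : M, tangent p) :
  (forall p, exists (d : smoothfun M) (W : vfield M), d p != 0 /\
     \forall q \near p, d q *: S q = W q) ->
  smooth_section S.
Proof.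
move=> h c p Ac cp; have [d [W [dp dS]]] := h p.
have [U [a [oU Ux Uc sa Wa]]] := vfield_smooth W Ac cp.
pose d' := d \o chart_inv c.
have sd : smooth_on (chart_cod c) d' by exact: smoothfunP.
have cd : {for c p, continuous d'}.
  apply: differentiable_continuous; apply: (smooth_on_differentiable sd).
  by exists p.
have nd : \forall x \near c p, d' x != 0.
  have d0 : d' (c p) != 0 by rewrite /d' /= chart_funK.
  exact: (cvgr_neq0 _ cd d0).
have nS := near_chart Ac cp dS.
have nU : \forall x \near c p, U x by exact: open_nbhs_nbhs.
pose P x := [/\ U x, d' x != 0 & d' x *: S (chart_inv c x) = W (chart_inv c x)].
have nP : \forall x \near c p, P x.
  by near=> x; split; near: x.
exists (interior P), (fun x => (d' x)^-1 *: a x).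
have oP : open (interior P) by exact: open_interior.
have PU : (interior P `<=` U)%classic by move=> x /nbhs_singleton [].
split => //.
- by move=> x /PU /Uc.
- move=> i; apply: (@eq_smooth_on _ _ _ _
    ((fun x => (d' x)^-1) \* (fun x => a x 0 i))) => //.
    by move=> x _; rewrite mxE.
  apply: smooth_onM => //; last exact: smooth_on_sub PU (sa i).
  have sd' : smooth_on (interior P) d'.
    by apply: smooth_on_sub sd => x /PU /Uc.
  by move=> k; apply: Cn_onV => // x /nbhs_singleton [].
- move=> x Px f; have [Uy dx Sx] := nbhs_singleton Px.
  have df : differentiable (f \o chart_inv c) x.
    exact: smoothfun_diff Ac (Uc _ Uy).
  rewrite deriveE // linearZ -deriveE // -Wa // -Sx.
  by rewrite -[RHS]/((d' x)^-1 * (d' x * S (chart_inv c x) f)) mulKf.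
Unshelve. all: by end_near. Qed.

Lemma subbundle_lin k E p (a b : R) (u v : tangent p) : subbundle k E ->
  E p u -> E p v -> E p (a *: u + b *: v).
Proof.
move=> sE; have [X /nbhs_singleton [_ ->]] := sE p.
move=> [c _ <-] [d _ <-]; exists (fun i => a * c i + b * d i) => //.
rewrite !scaler_sumr -big_split; apply: eq_bigr => i _.
by rewrite !scalerA scalerDl.
Qed.

Lemma orth_unique k E p (v u u' : tangent p) : subbundle k E ->
  E p u -> E p u' -> dorth g E (v - u) -> dorth g E (v - u') -> u = u'.
Proof.
move=> sE Eu Eu' ou ou'; apply/eqP; rewrite -subr_eq0; apply/eqP/metric_eq0.
have Euu' : E p (u - u').
  by have := subbundle_lin 1 (-1) sE Eu Eu'; rewrite scale1r scaleN1r.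
have -> : g p (u - u') (u - u') = g p (u - u') (v - u') - g p (u - u') (v - u).
  rewrite -metricNr -metricDr; congr (g p _ _).
  by rewrite opprB [RHS]addrC addrA subrK.
by rewrite ou // ou' // subrr.
Qed.

(** The pointwise projections are unique, so near each point they agree with
    the quotient that Cramer's rule gives for a local frame. *)
Lemma orthogonal_projection k E V : subbundle k E ->
  exists U, sections E U /\ sections (dorth g E) (V - U).
Proof.
move=> sE.
have quotient q (X : 'I_k -> vfield M) (W : vfield M) (d : smoothfun M) :
    E q = [set \sum_i c i *: X i q | c in [set: 'I_k -> R]]%classic ->
    [/\ d q != 0,
        exists c : 'I_k -> R, W q = \sum_i c i *: X i q &
        forall j, g q (W q) (X j q) = d q * g q (V q) (X j q)] ->
    E q ((d q)^-1 *: W q) /\ dorth g E (V q - (d q)^-1 *: W q).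
  move=> Eq [dq [c Wc] Wg]; split.
    rewrite Eq; exists (fun i => (d q)^-1 * c i) => //.
    by rewrite Wc scaler_sumr; apply: eq_bigr => i _; rewrite scalerA.
  move=> u; rewrite Eq => -[c' _ <-]; rewrite metric_suml big1 // => i _.
  rewrite metricZl metricC metricDl metricNl metricZl Wg mulKf //.
  by rewrite subrr mulr0.
have exS : forall p, exists u, E p u /\ dorth g E (V p - u).
  move=> p; have [X /nbhs_singleton [indep Ep]] := sE p.
  have [d [W dW]] := gram_cramer X V.
  by exists ((d p)^-1 *: W p); apply: quotient Ep (dW _ indep).
pose S p := sval (cid (exS p)).
have SE p : E p (S p) /\ dorth g E (V p - S p) := svalP (cid (exS p)).
suff smS : smooth_section S.
  exists (VField smS); split=> p; first by have [] := SE p.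
  by rewrite vfieldD vfieldN; have [] := SE p.
apply: smooth_section_quotient => p.
have [X nX] := sE p; have [d [W dW]] := gram_cramer X V.
exists d, W; split.
  by have [indep _] := nbhs_singleton nX; have [] := dW _ indep.
apply: filterS nX => q [indep Eq].
have [E1 E2] := quotient _ _ _ _ Eq (dW _ indep); have [E3 E4] := SE q.
rewrite (orth_unique sE E3 E1 E4 E2) scalerA mulfV ?scale1r //.
by have [] := dW _ indep.
Qed.

(** A combination of a local frame with constant coefficients is a global field
    known to lie in [E] near [p]; its projection lies in [E] everywhere and
    has the same value at [p]. *)
Lemma extend_vector k E p (u : tangent p) : subbundle k E -> E p u ->
  exists2 X, sections E X & X p = u.
Proof.
move=> sE Eu; have [X /nbhs_singleton [_ Ep]] := sE p.
have := Eu; rewrite Ep => -[c _ cu].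
have [U [EU oU]] := orthogonal_projection (\sum_i cstf (c i) *: X i) sE.
exists U => //; have := oU p; rewrite vfieldD vfieldN vfield_sumE.
rewrite (eq_bigr (fun i => c i *: X i p)) => [|i _]; last by rewrite vfieldZ.
rewrite cu => oUp; apply: orth_unique sE (EU p) Eu oUp _ => v _.
by rewrite subrr metric0r.
Qed.

(** Tangent vectors are coordinate vectors in a chart, so there are at most [m]
    independent ones. *)
Lemma tangent_dependent p (I : finType) (t : I -> tangent p) : (m < #|I|)%N ->
  exists2 c : I -> R, (exists i, c i != 0) & \sum_i c i *: t i = 0.
Proof.
move=> mI; have [ch Ac cp] := atlas_cover p.
have /choice [a ta] : forall i, exists a,
    forall f : smoothfun M, t i f = 'D_a (f \o chart_inv ch) (ch p).
  by move=> i; exact: tangentP.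
pose A : 'M[R]_(#|I|, m) := \matrix_i a (enum_val i).
have : kermx A != 0.
  rewrite kermx_eq0 /row_free; apply: contraTN mI => /eqP rA.
  by rewrite -leqNgt -[X in (X <= _)%N]rA rank_leq_col.
case/rowV0Pn => v /sub_kermxP vA v0; exists (fun i => v 0 (enum_rank i)).
  apply: contrapT => nv; case/eqP: v0; apply/rowP => i; rewrite mxE.
  apply/eqP; apply: contrapT => /negP vi; apply: nv; exists (enum_val i).
  by rewrite enum_valK.
apply: tangent_ext => f; pose F := f \o chart_inv ch.
have dF : differentiable F (ch p) by apply: smoothfun_diff => //; exists p.
transitivity (\sum_i v 0 (enum_rank i) * t i f).
  by apply: (big_morph (fun u : tangent p => u f)).
transitivity ('d F (ch p) (v *m A)); last by rewrite vA linear0.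
rewrite mulmx_sum_row linear_sum (reindex_onto enum_val enum_rank) /=; last first.
  by move=> i _; rewrite enum_rankK.
apply: eq_big => [i|i _]; first by rewrite enum_valK eqxx.
by rewrite enum_valK linearZ rowK -deriveE // ta.
Qed.

End Projection.

(** * Contact metric structures *)

Section FieldAlgebra.
Context {R : realType} {m : nat} {M : manifold R m}.
Context (phi : endo M) (eta : oneform M) (g : metric M).
Implicit Types (U V W X Y Z : vfield M) (f h : smoothfun M) (p q : M).

Lemma app_metricC V W : app_metric g V W = app_metric g W V.
Proof. by apply: smoothfun_ext => p; exact: metricC. Qed.

Lemma app_metricDl U V W :
  app_metric g (U + V) W = app_metric g U W + app_metric g V W.
Proof.
by apply: smoothfun_ext => p; rewrite -[LHS]/(g p _ _) vfieldD metricDl.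
Qed.

Lemma app_metricZl f V W : app_metric g (f *: V) W = f * app_metric g V W.
Proof.
by apply: smoothfun_ext => p; rewrite -[LHS]/(g p _ _) vfieldZ metricZl.
Qed.

Lemma app_metricNl V W : app_metric g (- V) W = - app_metric g V W.
Proof. by rewrite -scaleN1r app_metricZl mulN1r. Qed.

Lemma app_metric0l W : app_metric g 0 W = 0.
Proof. by rewrite -(scale0r 0) app_metricZl mul0r. Qed.

Lemma app_metricDr U V W :
  app_metric g W (U + V) = app_metric g W U + app_metric g W V.
Proof. by rewrite app_metricC app_metricDl !(app_metricC W). Qed.

Lemma app_metricZr f V W : app_metric g W (f *: V) = f * app_metric g W V.
Proof. by rewrite app_metricC app_metricZl (app_metricC W). Qed.

Lemma app_metricNr V W : app_metric g W (- V) = - app_metric g W V.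
Proof. by rewrite app_metricC app_metricNl (app_metricC W). Qed.

Lemma app_metric0r W : app_metric g W 0 = 0.
Proof. by rewrite app_metricC app_metric0l. Qed.

Definition app_metricE := (app_metricDl, app_metricDr, app_metricNl, app_metricNr,
  app_metricZl, app_metricZr, app_metric0l, app_metric0r).

Lemma app_metric_eq0 V : app_metric g V V = 0 -> V = 0.
Proof.
move=> gV; apply: vfield_ext => p; apply: (@metric_eq0 _ _ _ g).
exact: (smoothfun_at p gV).
Qed.

Lemma app_metric_inj V W :
  (forall Z, app_metric g V Z = app_metric g W Z) -> V = W.
Proof.
move=> VW; apply/eqP; rewrite -subr_eq0; apply/eqP/app_metric_eq0.
by rewrite app_metricDl app_metricNl VW subrr.
Qed.

Lemma app_endoD V W : app_endo phi (V + W) = app_endo phi V + app_endo phi W.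
Proof.
by apply: vfield_ext => p; rewrite -[LHS]/(phi p _) !vfieldD linearD.
Qed.

Lemma app_endoZ f V : app_endo phi (f *: V) = f *: app_endo phi V.
Proof.
by apply: vfield_ext => p; rewrite -[LHS]/(phi p _) !vfieldZ linearZ.
Qed.

Lemma app_endoN V : app_endo phi (- V) = - app_endo phi V.
Proof. by rewrite -scaleN1r app_endoZ scaleN1r. Qed.

Definition app_endoE := (app_endoD, app_endoN, app_endoZ).

Lemma app_formD V W : app_form eta (V + W) = app_form eta V + app_form eta W.
Proof.
by apply: smoothfun_ext => p; rewrite -[LHS]/(eta p _) vfieldD linearD.
Qed.

Lemma app_formZ f V : app_form eta (f *: V) = f * app_form eta V.
Proof.
by apply: smoothfun_ext => p; rewrite -[LHS]/(eta p _) vfieldZ linearZ.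
Qed.

Lemma app_formN V : app_form eta (- V) = - app_form eta V.
Proof. by rewrite -scaleN1r app_formZ mulN1r. Qed.

Definition app_formE := (app_formD, app_formN, app_formZ).

Lemma dformC V W : dform eta V W = - dform eta W V.
Proof. by rewrite /dform (bracketC V) app_formN; ring. Qed.

End FieldAlgebra.

Section ContactMetric.
Context {R : realType} {n : nat} {M : manifold R n.*2.+1}.
Context {phi : endo M} {xi : vfield M} {eta : oneform M} {g : metric M}.
Context (contactM : contact_metric phi xi eta g).
Implicit Types (U V W X Y Z : vfield M) (f h : smoothfun M) (p q : M).
Implicit Types (E F L : distribution M).

Lemma contact_form_xi : app_form eta xi = 1.
Proof. by case: contactM => _ []. Qed.

Lemma contact_dform_xi W : dform eta xi W = 0.
Proof. by case: contactM => _ [_ +] _ _ _; exact. Qed.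

Lemma contact_metric_xi V : app_metric g V xi = app_form eta V.
Proof. by case: contactM. Qed.

Lemma contact_phi2 V : app_endo phi (app_endo phi V) = - V + app_form eta V *: xi.
Proof. by case: contactM. Qed.

Lemma contact_dformE V W : dform eta V W = app_metric g V (app_endo phi W).
Proof. by case: contactM. Qed.

Lemma metric_phi_skew V W :
  app_metric g (app_endo phi V) W = - app_metric g V (app_endo phi W).
Proof. by rewrite app_metricC -!contact_dformE dformC. Qed.

Lemma dformDl U V W : dform eta (U + V) W = dform eta U W + dform eta V W.
Proof. by rewrite !contact_dformE app_metricDl. Qed.

Lemma dformZl f V W : dform eta (f *: V) W = f * dform eta V W.
Proof. by rewrite !contact_dformE app_metricZl. Qed.

Lemma dformDr U V W : dform eta W (U + V) = dform eta W U + dform eta W V.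
Proof. by rewrite !contact_dformE app_endoD app_metricDr. Qed.

Lemma dformZr f V W : dform eta W (f *: V) = f * dform eta W V.
Proof. by rewrite !contact_dformE app_endoZ app_metricZr. Qed.

Lemma dform0l W : dform eta 0 W = 0.
Proof. by rewrite -(scale0r 0) dformZl mul0r. Qed.

Lemma contact_form_phi V : app_form eta (app_endo phi V) = 0.
Proof.
by rewrite -contact_metric_xi app_metricC -contact_dformE contact_dform_xi.
Qed.

Lemma contact_phi_xi : app_endo phi xi = 0.
Proof.
apply: (@app_metric_eq0 _ _ _ g).
by rewrite -contact_dformE dformC contact_dform_xi oppr0.
Qed.

Lemma metric_phi V W : app_metric g (app_endo phi V) (app_endo phi W) =
  app_metric g V W - app_form eta V * app_form eta W.
Proof.
rewrite metric_phi_skew contact_phi2 !app_metricE contact_metric_xi; ring.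
Qed.

Lemma metric_xi_at p (u : tangent p) V : V p = u -> g p u (xi p) = eta p u.
Proof.
by move=> <-; exact: (smoothfun_at p (contact_metric_xi V)).
Qed.

(** Dimension count: [W] is orthogonal to the [2n+1] independent vectors given
    by a frame of [L], its image under [phi], and [xi]; if it were nonzero, it
    would make them [2n+2]. *)
Lemma legendrian_maximal L W : legendrian eta L ->
  sections (dorth g L) W -> sections (dorth g L) (app_endo phi W) ->
  app_form eta W = 0 -> W = 0.
Proof.
move=> [sL Leta Ldform] oW ophiW etaW.
apply: vfield_ext => p; apply/eqP; apply: contrapT => /negP Wp0.
have [X /nbhs_singleton [indep Lp]] := sL p.
pose t (i : ('I_n + 'I_n) + bool) : tangent p :=
  match i with
  | inl (inl i) => X i p
  | inl (inr i) => app_endo phi (X i) p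
  | inr true => xi p
  | inr false => W p
  end.
have [|c [i ci0]] := tangent_dependent t.
  by rewrite card_sum card_bool card_sum card_ord addn2 addnn.
rewrite big_sumType big_sumType big_bool /=.
pose A : vfield M := \sum_i cstf (c (inl (inl i))) *: X i.
pose B : vfield M := \sum_i cstf (c (inl (inr i))) *: X i.
have Ap : A p = \sum_i c (inl (inl i)) *: X i p.
  by rewrite vfield_sumE; apply: eq_bigr => j _; rewrite vfieldZ.
have Bp : B p = \sum_i c (inl (inr i)) *: X i p.
  by rewrite vfield_sumE; apply: eq_bigr => j _; rewrite vfieldZ.
have phiBp : app_endo phi B p = \sum_i c (inl (inr i)) *: app_endo phi (X i) p.
  rewrite -[LHS]/(phi p (B p)) Bp linear_sum.
  by apply: eq_bigr => j _; rewrite linearZ.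
rewrite -Ap -phiBp => sum0.
have LA : L p (A p) by rewrite Lp Ap; exists (fun i => c (inl (inl i))).
have LB : L p (B p) by rewrite Lp Bp; exists (fun i => c (inl (inr i))).
have gAB : g p (A p) (app_endo phi B p) = 0.
  have [A' LA' <-] := extend_vector g sL LA.
  have [B' LB' B'p] := extend_vector g sL LB.
  rewrite -[app_endo phi B p]/(phi p (B p)) -B'p.
  by have := smoothfun_at p (Ldform _ _ LA' LB'); rewrite contact_dformE.
have gWW : g p (W p) (W p) != 0.
  by apply: contra Wp0 => /eqP /metric_eq0 ->.
have gxi V : g p (V p) (xi p) = eta p (V p) by exact: metric_xi_at.
have gWA : g p (A p) (W p) = 0 by exact: oW.
have gWB : g p (app_endo phi B p) (W p) = 0.
  transitivity (- g p (B p) (app_endo phi W p)).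
    exact: (smoothfun_at p (metric_phi_skew B W)).
  by rewrite (ophiW p _ LB) oppr0.
have gxiW : g p (xi p) (W p) = 0.
  by rewrite metricC gxi; exact: (smoothfun_at p etaW).
have c4 : c (inr false) = 0.
  have := congr1 (fun u => g p u (W p)) sum0.
  rewrite /= !metricDl !metricZl gWA gWB gxiW metric0l mulr0 !add0r.
  by move/eqP; rewrite mulf_eq0 (negPf gWW) orbF => /eqP.
have xixi : g p (xi p) (xi p) = 1.
  by rewrite gxi; exact: (smoothfun_at p contact_form_xi).
have c3 : c (inr true) = 0.
  have := congr1 (fun u => g p u (xi p)) sum0.
  rewrite /= c4 scale0r addr0 !metricDl metricZl xixi mulr1 metric0l !gxi.
  have gBxi : g p (phi p (B p)) (xi p) = 0.
    rewrite (gxi (app_endo phi B)).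
    exact: (smoothfun_at p (contact_form_phi B)).
  by rewrite (Leta p _ LA) gBxi !add0r.
move: sum0; rewrite c3 c4 !scale0r !addr0 => sum0.
have A0 : A p = 0.
  apply: (@metric_eq0 _ _ _ g); have := congr1 (g p (A p)) sum0.
  by rewrite metricDr gAB addr0 metric0r.
have B0 : B p = 0.
  move: sum0; rewrite A0 add0r => phiB0.
  have := congr1 (fun V : vfield M => V p) (contact_phi2 B).
  rewrite /= -[RHS]/((- B + app_form eta B *: xi) p) vfieldD vfieldN vfieldZ.
  rewrite -[app_form eta B p]/(eta p (B p)) (Leta p _ LB) scale0r addr0.
  rewrite -[LHS]/(phi p (app_endo phi B p)) phiB0 linear0.
  by move=> /eqP; rewrite eq_sym oppr_eq0 => /eqP.
case/negP: ci0; apply/eqP; case: i => [[i|i]|[]] //.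
  by apply: (indep (fun i => c (inl (inl i)))); rewrite -Ap.
by apply: (indep (fun i => c (inl (inr i)))); rewrite -Bp.
Qed.

End ContactMetric.

(** * Splittings of the tangent bundle *)

Section Splitting.
Context {R : realType} {n : nat} {M : manifold R n.*2.+1}.
Context {phi : endo M} {xi : vfield M} {eta : oneform M} {g : metric M}.
Implicit Types (U V W X Y Z : vfield M) (f h : smoothfun M) (p q : M).
Implicit Types (A B E F L : distribution M).

(** What a Legendrian distribution and its conjugate satisfy, in a form symmetric
    in the two, so that each later lemma also serves with [E] and [F]
    exchanged. *)
Record contact_splitting E F : Prop := ContactSplitting {
  split_contact : contact_metric phi xi eta g;
  split_linl : forall p (a b : R) (u v : tangent p),
    E p u -> E p v -> E p (a *: u + b *: v);
  split_linr : forall p (a b : R) (u v : tangent p),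
    F p u -> F p v -> F p (a *: u + b *: v);
  split_xil : forall p (u : tangent p), E p u -> g p u (xi p) = 0;
  split_xir : forall p (u : tangent p), F p u -> g p u (xi p) = 0;
  split_orth : forall p (u v : tangent p), E p u -> F p v -> g p u v = 0;
  split_phil : forall p (u : tangent p), E p u -> F p (phi p u);
  split_phir : forall p (u : tangent p), F p u -> E p (phi p u);
  split_dec : forall V, exists X Y,
    [/\ sections E X, sections F Y & V = X + Y + app_form eta V *: xi]
}.

Lemma contact_splittingC E F : contact_splitting E F -> contact_splitting F E.
Proof.
case=> cM lE lF xE xF oEF pE pF dec; split => //.
  by move=> p u v Fu Ev; rewrite metricC oEF.
move=> V; have [X [Y [EX FY VE]]] := dec V.
by exists Y, X; rewrite (addrC Y).
Qed.

(** The [phi L] component of [V] is [- phi ((phi V)_L)], so that the projection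
    onto [L] alone already splits [V]. *)
Lemma legendrian_splitting L : contact_metric phi xi eta g ->
  legendrian eta L -> contact_splitting L (dimage phi L).
Proof.
move=> contactM legL; have [sL Leta Ldform] := legL.
have lin p (a b : R) (u v : tangent p) : L p u -> L p v -> L p (a *: u + b *: v).
  by move=> Lu Lv; exact: subbundle_lin sL Lu Lv.
have orth X X' : sections L X -> sections L X' ->
    app_metric g X (app_endo phi X') = 0.
  by move=> LX LX'; rewrite -(contact_dformE contactM) Ldform.
have formL X : sections L X -> app_form eta X = 0.
  by move=> LX; apply: smoothfun_ext => p; apply: Leta; exact: LX.
have phi2 X : sections L X -> app_endo phi (app_endo phi X) = - X.
  by move=> LX; rewrite (contact_phi2 contactM) formL // scale0r addr0.
split => //.
- move=> p a b _ _ [u Lu <-] [v Lv <-]; exists (a *: u + b *: v).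
    exact: lin.
  by rewrite linearD !linearZ.
- move=> p u Lu; have [X LX Xu] := extend_vector g sL Lu.
  by rewrite (metric_xi_at contactM Xu) Leta.
- move=> p _ [u Lu <-]; have [X LX Xu] := extend_vector g sL Lu.
  have phiXu : app_endo phi X p = phi p u by rewrite -Xu.
  rewrite (metric_xi_at contactM phiXu) -phiXu.
  exact: (smoothfun_at p (contact_form_phi contactM X)).
- move=> p u _ Lu [v Lv <-].
  have [X LX <-] := extend_vector g sL Lu.
  have [Y LY <-] := extend_vector g sL Lv.
  exact: (smoothfun_at p (orth X Y LX LY)).
- by move=> p u Lu; exists u.
- move=> p _ [u Lu <-]; have [X LX <-] := extend_vector g sL Lu.
  have -> : phi p (phi p (X p)) = - X p.
    by rewrite -vfieldN -(phi2 _ LX).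
  by rewrite -scaleN1r -[-1 *: _]addr0 -(scale0r (X p)); apply: lin; exact: LX.
move=> V; have [X [LX oX]] := orthogonal_projection g V sL.
have [Y [LY oY]] := orthogonal_projection g (app_endo phi V) sL.
exists X, (- app_endo phi Y); split => //.
  move=> p; exists (- Y p); last by rewrite linearN vfieldN.
  by rewrite -scaleN1r -[-1 *: _]addr0 -(scale0r (Y p)); apply: lin; exact: LY.
(* The error [W] is orthogonal to [L], to [phi L] and to [xi]. *)
pose W := V - (X - app_endo phi Y + app_form eta V *: xi).
apply/eqP; rewrite -subr_eq0 -/W; apply/eqP.
have orth_section Z : (forall X', sections L X' -> app_metric g X' Z = 0) ->
    sections (dorth g L) Z.
  move=> oZ p u Lu; have [X' LX' <-] := extend_vector g sL Lu.
  exact: (smoothfun_at p (oZ X' LX')).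
have section_orth Z X' : sections L X' -> sections (dorth g L) Z ->
    app_metric g X' Z = 0.
  by move=> LX' oZ; apply: smoothfun_ext => p; apply: oZ; exact: LX'.
have gVX X' : sections L X' -> app_metric g X' V = app_metric g X' X.
  move=> LX'; apply/eqP; rewrite -subr_eq0 -app_metricNr -app_metricDr.
  by rewrite section_orth.
have gphiV X' : sections L X' ->
    app_metric g X' (app_endo phi V) = app_metric g X' Y.
  move=> LX'; apply/eqP; rewrite -subr_eq0 -app_metricNr -app_metricDr.
  by rewrite section_orth.
have gxi X' : sections L X' -> app_metric g X' xi = 0.
  by move=> LX'; rewrite (contact_metric_xi contactM) formL.
apply: (legendrian_maximal contactM legL).
- apply: orth_section => X' LX'; rewrite /W !opprD opprK !app_metricE.
  by rewrite gVX // gxi // orth //; ring.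
- apply: orth_section => X' LX'.
  rewrite /W !opprD opprK !app_endoE (contact_phi_xi contactM) phi2 //.
  rewrite scaler0 oppr0 addr0 !app_metricE gphiV // orth //; ring.
- rewrite /W !app_formE (formL X) // (contact_form_phi contactM).
  by rewrite (contact_form_xi contactM); ring.
Qed.

(** [proj] is a choice among the possible components; orthogonality makes the
    component unique, which is how its values are computed. *)
Lemma proj_orth A B U V : (forall p u v, A p u -> B p v -> g p u v = 0) ->
  sections A U -> sections B (V - U) -> proj A B V = U.
Proof.
move=> oAB AU BU; apply: xget_unique; first by split.
move=> U' [AU' BU'].
have orth Z Z' : sections A Z -> sections B Z' -> app_metric g Z Z' = 0.
  by move=> AZ BZ'; apply: smoothfun_ext => p; apply: oAB; [exact: AZ|exact: BZ'].
apply/eqP; rewrite -subr_eq0; apply/eqP/(@app_metric_eq0 _ _ _ g).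
have {2}-> : U' - U = (V - U) - (V - U').
  by rewrite opprB [RHS]addrC addrA subrK.
have expand Z Z' : app_metric g (U' - U) (Z - Z') =
    app_metric g U' Z - app_metric g U' Z' -
    (app_metric g U Z - app_metric g U Z').
  by rewrite !app_metricE; ring.
by rewrite expand !orth // subrr.
Qed.

Section Sections.
Context {E F : distribution M} (sp : contact_splitting E F).
Let contactM := split_contact sp.

Lemma sections_lin f h X X' : sections E X -> sections E X' ->
  sections E (f *: X + h *: X').
Proof.
move=> EX EX' p; rewrite vfieldD !vfieldZ; apply: (split_linl sp).
  exact: EX.
exact: EX'.
Qed.

Lemma sectionsD X X' : sections E X -> sections E X' -> sections E (X + X').
Proof.
by move=> EX EX'; have := sections_lin 1 1 EX EX'; rewrite !scale1r.
Qed.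

Lemma sectionsZ f X : sections E X -> sections E (f *: X).
Proof.
by move=> EX; have := sections_lin f 0 EX EX; rewrite scale0r addr0.
Qed.

Lemma sectionsN X : sections E X -> sections E (- X).
Proof. by move=> EX; rewrite -scaleN1r; exact: sectionsZ. Qed.

Lemma sections0 : sections E 0.
Proof.
have [X [_ [EX _ _]]] := split_dec sp 0.
by rewrite -(scale0r X); exact: sectionsZ.
Qed.

Lemma sections_phi X : sections E X -> sections F (app_endo phi X).
Proof. by move=> EX p; apply: (split_phil sp); exact: EX. Qed.

Lemma sections_form X : sections E X -> app_form eta X = 0.
Proof.
move=> EX; rewrite -(contact_metric_xi contactM); apply: smoothfun_ext => p.
by apply: (split_xil sp); exact: EX.
Qed.

Lemma sections_xi X : sections E X -> app_metric g X xi = 0.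
Proof. by move=> EX; rewrite (contact_metric_xi contactM) sections_form. Qed.

Lemma sections_orth X Y : sections E X -> sections F Y -> app_metric g X Y = 0.
Proof.
move=> EX FY; apply: smoothfun_ext => p.
by apply: (split_orth sp); [exact: EX|exact: FY].
Qed.

Lemma sections_phi2 X : sections E X -> app_endo phi (app_endo phi X) = - X.
Proof.
by move=> EX; rewrite (contact_phi2 contactM) sections_form // scale0r addr0.
Qed.

Lemma sections_dsum_xi Y f : sections F Y ->
  sections (dsum F (dline xi)) (Y + f *: xi).
Proof.
move=> FY p; exists (Y p); first exact: FY.
by exists (f p *: xi p); [exists (f p)|rewrite vfieldD vfieldZ].
Qed.

Lemma split_orth_xi p (u v : tangent p) :
  E u -> dsum F (dline xi) v -> g p u v = 0.
Proof.
move=> Eu [w Fw [_ [k _ <-] <-]].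
by rewrite metricDr metricZr (split_orth sp Eu Fw) (split_xil sp Eu) mulr0 addr0.
Qed.

Local Notation prE := (proj E (dsum F (dline xi))).
Local Notation prF := (proj F (dsum E (dline xi))).

Lemma proj_split X Y f : sections E X -> sections F Y ->
  prE (X + Y + f *: xi) = X.
Proof.
move=> EX FY; apply: proj_orth => //; first exact: split_orth_xi.
by rewrite -(addrA X) (addrC _ (- X)) addKr; exact: sections_dsum_xi.
Qed.

Lemma proj_section V : sections E (prE V).
Proof.
have [X [Y [EX FY ->]]] := split_dec sp V.
by rewrite proj_split.
Qed.

End Sections.

Section Components.
Context {E F : distribution M} (sp : contact_splitting E F).
Let contactM := split_contact sp.
Let sp' := contact_splittingC sp.

Local Notation prE := (proj E (dsum F (dline xi))).
Local Notation prF := (proj F (dsum E (dline xi))).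

Lemma proj_dec V : V = prE V + prF V + app_form eta V *: xi.
Proof.
have [X [Y [EX FY VE]]] := split_dec sp V.
have eE : prE V = X by rewrite VE (proj_split sp).
have eF : prF V = Y by rewrite VE (addrC X) (proj_split sp').
by rewrite eE eF.
Qed.

(** Reduces a property that is linear over the functions to the three summands;
    it is used once for each argument of a tensor. *)
Lemma split_ind (P : vfield M -> Prop) :
  (forall f U V, P U -> P V -> P (f *: U + V)) ->
  (forall X, sections E X -> P X) -> (forall Y, sections F Y -> P Y) -> P xi ->
  forall V, P V.
Proof.
move=> Plin PE PF Pxi V; rewrite (proj_dec V) addrC; apply: (Plin) => //.
rewrite -[prE V]scale1r; apply: (Plin).
  by apply: PE; exact: (proj_section sp).
by apply: PF; exact: (proj_section sp').
Qed.

Lemma proj_metric V X : sections E X -> app_metric g (prE V) X = app_metric g V X.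
Proof.
move=> EX; rewrite [in RHS](proj_dec V) !app_metricDl app_metricZl.
rewrite (app_metricC _ (prF V)) (sections_orth sp EX (proj_section sp' V)).
by rewrite (app_metricC _ xi) (sections_xi sp EX); ring.
Qed.

Lemma proj_unique U V : sections E U ->
  (forall X, sections E X -> app_metric g U X = app_metric g V X) -> prE V = U.
Proof.
move=> EU gU; apply/eqP; rewrite -subr_eq0; apply/eqP.
have ED : sections E (prE V - U).
  by apply: (sectionsD sp); [exact: (proj_section sp)|exact: (sectionsN sp)].
apply: (@app_metric_eq0 _ _ _ g); rewrite {1}app_metricDl app_metricNl.
by rewrite gU // proj_metric // subrr.
Qed.

Lemma projD V W : prE (V + W) = prE V + prE W.
Proof.
apply: proj_unique => [|X EX].
  by apply: (sectionsD sp); exact: (proj_section sp).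
by rewrite !app_metricDl !proj_metric.
Qed.

Lemma projZ f V : prE (f *: V) = f *: prE V.
Proof.
apply: proj_unique => [|X EX].
  by apply: (sectionsZ sp); exact: (proj_section sp).
by rewrite !app_metricZl proj_metric.
Qed.

Lemma projN V : prE (- V) = - prE V.
Proof. by rewrite -scaleN1r projZ scaleN1r. Qed.

Lemma proj_id X : sections E X -> prE X = X.
Proof. by move=> EX; exact: proj_unique. Qed.

Lemma proj_orth_eq0 V :
  (forall X, sections E X -> app_metric g V X = 0) -> prE V = 0.
Proof.
move=> oV; apply: proj_unique => [|X EX]; first exact: (sections0 sp).
by rewrite app_metric0l oV.
Qed.

Lemma proj_compl Y : sections F Y -> prE Y = 0.
Proof.
by move=> FY; apply: proj_orth_eq0 => X EX; exact: (sections_orth sp').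
Qed.

Lemma proj_xi : prE xi = 0.
Proof.
by apply: proj_orth_eq0 => X EX; rewrite app_metricC (sections_xi sp).
Qed.

Lemma proj0 : prE 0 = 0.
Proof. exact/proj_compl/(sections0 sp'). Qed.

Lemma proj_line V : proj (dline xi) (dsum E F) V = app_form eta V *: xi.
Proof.
apply: (@proj_orth _ _ _ V) => [p u v|p|p].
- move=> [k _ <-] [w Ew [z Fz <-]]; rewrite metricZl metricDr.
  by rewrite !(metricC g (xi p)) (split_xil sp Ew) (split_xir sp Fz) addr0 mulr0.
- by exists (app_form eta V p) => //; rewrite vfieldZ.
- exists (prE V p); first exact: (proj_section sp).
  exists (prF V p); first exact: (proj_section sp').
  by rewrite {3}(proj_dec V) addrK vfieldD.
Qed.

Lemma sections_dorthP Z :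
  sections (dorth g (dsum E (dline xi))) Z <-> sections F Z.
Proof.
split=> [oZ|FZ p u Eu]; last first.
  by rewrite metricC; apply: (split_orth_xi sp') Eu; exact: FZ.
have gEZ X : sections E X -> app_metric g Z X = 0.
  move=> EX; rewrite app_metricC; apply: smoothfun_ext => p; apply: oZ.
  exists (X p); first exact: EX.
  by exists 0; [exists 0 => //; rewrite scale0r|rewrite addr0].
have formZ : app_form eta Z = 0.
  rewrite -(contact_metric_xi contactM) app_metricC.
  apply: smoothfun_ext => p; apply: oZ.
  exists 0; first by have := sections0 sp p.
  by exists (xi p); [exists 1 => //; rewrite scale1r|rewrite add0r].
rewrite (proj_dec Z) proj_orth_eq0 // formZ scale0r add0r addr0.
exact: (proj_section sp').
Qed.

End Components.

Section Exchange.
Context {E F : distribution M} (sp : contact_splitting E F).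
Let contactM := split_contact sp.
Let sp' := contact_splittingC sp.

Lemma proj_phi V : proj E (dsum F (dline xi)) (app_endo phi V) =
  app_endo phi (proj F (dsum E (dline xi)) V).
Proof.
apply: (proj_unique sp) => [|X EX].
  by apply: (sections_phi sp'); exact: (proj_section sp').
rewrite !(metric_phi_skew contactM) (proj_metric sp') //.
exact: (sections_phi sp).
Qed.

Lemma sections_dsum_xiP V : sections (dsum E (dline xi)) V ->
  V = proj E (dsum F (dline xi)) V + app_form eta V *: xi.
Proof.
move=> EV; have FV : proj F (dsum E (dline xi)) V = 0.
  apply: (proj_orth_eq0 sp') => Y FY; rewrite app_metricC.
  by apply: smoothfun_ext => p; apply: (split_orth_xi sp'); [exact: FY|exact: EV].
by have := proj_dec sp V; rewrite FV addr0.
Qed.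

End Exchange.
End Splitting.

Arguments contact_splitting {R n M} phi xi eta g E F.

(** * The bi-Legendrian connection *)

Section LieDerivative.
Context {R : realType} {m : nat} {M : manifold R m}.
Context {eta : oneform M} {xi : vfield M}.
Context (reeb : is_reeb eta xi).
Implicit Types (V W : vfield M) (f : smoothfun M).

Lemma reeb_form_bracket V :
  app_form eta (bracket xi V) = vder xi (app_form eta V).
Proof.
have [eta1 deta] := reeb; have := deta V; rewrite /dform eta1 vder1 subr0.
move=> /(congr1 (fun f => f + f)); rewrite addr0 -mulrDr half_double => /eqP.
by rewrite subr_eq0 eq_sym => /eqP.
Qed.

(** [L_xi (d eta) = d (L_xi eta) = 0]. *)
Lemma reeb_lie_dform V W : vder xi (dform eta V W) =
  dform eta (bracket xi V) W + dform eta V (bracket xi W).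
Proof.
rewrite /dform vderM vder_cst mulr0 addr0 -mulrDr; congr (_ * _).
rewrite !vderD !vderN !vder_bracket -!reeb_form_bracket jacobi app_formD.
by rewrite !reeb_form_bracket; ring.
Qed.

End LieDerivative.

Section Connection.
Context {R : realType} {n : nat} {M : manifold R n.*2.+1}.
Context {phi : endo M} {xi : vfield M} {eta : oneform M} {g : metric M}.
Context {nabla : vfield M -> vfield M -> vfield M}.
Implicit Types (U V W X Y Z : vfield M) (f h : smoothfun M) (p q : M).
Implicit Types (E F : distribution M).

Lemma dsumC E F : dsum E F = dsum F E.
Proof.
apply: functional_extensionality_dep => p.
apply/seteqP; split=> w [u Eu [v Fv <-]].
  by exists v => //; exists u => //; rewrite addrC.
by exists v => //; exists u => //; rewrite addrC.
Qed.

Lemma biLegendrianC E F : biLegendrian_connection eta xi E F nabla ->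
  biLegendrian_connection eta xi F E nabla.
Proof.
move=> [cn [H HH [n1 n2 n3]]]; split => //; exists H => //; split=> // W X ?.
  by rewrite (dsumC F E); exact: n2.
by rewrite (dsumC F E); exact: n1.
Qed.

Section Linear.
Context (conn : is_connection nabla).

Lemma nablaDl W W' V : nabla (W + W') V = nabla W V + nabla W' V.
Proof. by have [nl _ _] := conn; rewrite -[W]scale1r nl !scale1r. Qed.

Lemma nabla0l V : nabla 0 V = 0.
Proof. by apply: (addrI (nabla 0 V)); rewrite -nablaDl !addr0. Qed.

Lemma nablaZl f W V : nabla (f *: W) V = f *: nabla W V.
Proof.
by have [nl _ _] := conn; rewrite -[f *: W]addr0 nl nabla0l addr0.
Qed.

Lemma nablaDr W V V' : nabla W (V + V') = nabla W V + nabla W V'.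
Proof. by have [_ + _] := conn; exact. Qed.

Lemma nablaZr f W V : nabla W (f *: V) = vder W f *: V + f *: nabla W V.
Proof. by have [_ _] := conn; exact. Qed.

Lemma nablaNr W V : nabla W (- V) = - nabla W V.
Proof. by rewrite -scaleN1r nablaZr vderN vder1 oppr0 scale0r add0r scaleN1r. Qed.

(** The covariant derivative of [g]; its tensoriality reduces [nabla g = 0] to
    fields taken from the summands of a splitting. *)
Definition nabla_metric W V V' : smoothfun M :=
  vder W (app_metric g V V') - app_metric g (nabla W V) V'
  - app_metric g V (nabla W V').

Lemma nabla_metricC W V V' : nabla_metric W V V' = nabla_metric W V' V.
Proof.
rewrite /nabla_metric (app_metricC _ V) (app_metricC _ (nabla W V)).
by rewrite (app_metricC _ V); ring.
Qed.

Lemma nabla_metric_linl f W W' V V' : nabla_metric (f *: W + W') V V' =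
  f * nabla_metric W V V' + nabla_metric W' V V'.
Proof.
by rewrite /nabla_metric !nablaDl !nablaZl !app_metricE vderDv vderZv; ring.
Qed.

Lemma nabla_metric_lin W f U V V' : nabla_metric W (f *: U + V) V' =
  f * nabla_metric W U V' + nabla_metric W V V'.
Proof.
rewrite /nabla_metric !nablaDr !nablaZr !app_metricE vderD vderM; ring.
Qed.

Lemma parallel_metricP : parallel_metric nabla g <->
  forall W V V', nabla_metric W V V' = 0.
Proof.
split=> [pg W V V'|pg W V V'].
  by rewrite /nabla_metric pg; ring.
have /eqP := pg W V V'; rewrite /nabla_metric -addrA -opprD subr_eq0.
by move/eqP.
Qed.

Context (contactM : contact_metric phi xi eta g).

Definition nabla_dform W V V' : smoothfun M :=
  vder W (dform eta V V') - dform eta (nabla W V) V' - dform eta V (nabla W V').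

Lemma nabla_dformC W V V' : nabla_dform W V V' = - nabla_dform W V' V.
Proof.
rewrite /nabla_dform (dformC eta V) (dformC eta (nabla W V)) (dformC eta V) vderN.
ring.
Qed.

Lemma nabla_dform_linl f W W' V V' : nabla_dform (f *: W + W') V V' =
  f * nabla_dform W V V' + nabla_dform W' V V'.
Proof.
rewrite /nabla_dform !nablaDl !nablaZl vderDv vderZv.
rewrite !(dformDl contactM) !(dformDr contactM) !(dformZl contactM).
by rewrite (dformZr contactM); ring.
Qed.

Lemma nabla_dform_lin W f U V V' : nabla_dform W (f *: U + V) V' =
  f * nabla_dform W U V' + nabla_dform W V V'.
Proof.
rewrite /nabla_dform !nablaDr !nablaZr.
rewrite !(dformDl contactM) !(dformZl contactM) vderD vderM.
ring.
Qed.

End Linear.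

Section OneSide.
Context {E F : distribution M} (sp : contact_splitting phi xi eta g E F).
Context (bl : biLegendrian_connection eta xi E F nabla).
Let contactM := split_contact sp.
Let dformE := contact_dformE contactM.
Let sp' := contact_splittingC sp.
Let conn : is_connection nabla. Proof. by case: bl. Qed.

Local Notation prE := (proj E (dsum F (dline xi))).
Local Notation prF := (proj F (dsum E (dline xi))).

Lemma nabla_section W X : sections E X -> sections E (nabla W X).
Proof.
move=> EX; have [_ [H _ [-> // _ _]]] := bl.
by do ![apply: (sectionsD sp)|exact: (proj_section sp)].
Qed.

Lemma nabla_xi W : nabla W xi = 0.
Proof.
by have [_ [H _ [_ _ nx]]] := bl; have := nx W 1; rewrite scale1r vder1 scale0r.
Qed.

(** Nondegeneracy of [d eta] on [ker eta], tested against [phi V]. *)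
Lemma dform_eq0 V : sections (dker eta) V ->
  (forall Z, sections (dker eta) Z -> dform eta V Z = 0) -> V = 0.
Proof.
move=> DV dV; apply: (@app_metric_eq0 _ _ _ g).
have etaV : app_form eta V = 0 by exact: smoothfun_ext.
have := dV (app_endo phi V).
rewrite dformE (contact_phi2 contactM) etaV scale0r addr0 app_metricNr => dV0.
apply/eqP; rewrite -oppr_eq0 dV0 // => p.
exact: (smoothfun_at p (contact_form_phi contactM V)).
Qed.

(** In directions without [E] component the [H] term of the definition vanishes
    and the other two combine into one bracket. *)
Lemma nabla_bracket V X : sections E X -> prE V = 0 ->
  nabla V X = prE (bracket V X).
Proof.
move=> EX V0; have [_ [H HH [-> // _ _]]] := bl.
have H0 : H 0 X = 0.
  have [DH dH] := HH 0 X; apply: dform_eq0 => // Z DZ.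
  by rewrite dH // vder0v bracket0l dformC dformE app_metric0l; ring.
rewrite V0 H0 (proj0 sp) add0r (proj_line sp).
have eV : V = prF V + app_form eta V *: xi.
  by have := proj_dec sp V; rewrite V0 add0r.
by rewrite -(projD sp) -bracketDl -eV.
Qed.

Lemma dform_proj X V : sections E X -> dform eta X (prF V) = dform eta X V.
Proof.
move=> EX; rewrite dformC dformE (proj_metric sp'); last exact: (sections_phi sp).
by rewrite -dformE -dformC.
Qed.

(** Pairing with [F] only sees the [E] component of [H], so the defining
    property of [H] becomes the case of [nabla (d eta) = 0] with the derivative
    taken along [E]. *)
Lemma nabla_dform_along X X' Y : sections E X -> sections E X' -> sections F Y ->
  vder X (dform eta X' Y) =
  dform eta (nabla X X') Y + dform eta X' (prF (bracket X Y)).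
Proof.
move=> EX EX' FY; have [_ [H HH [nX _ _]]] := bl.
have EphiY : sections E (app_endo phi Y) by exact: (sections_phi sp').
have DY : sections (dker eta) Y.
  by move=> p; exact: (smoothfun_at p (sections_form sp' FY)).
have [_ /(_ Y DY) dH] := HH X X'.
rewrite nX // (proj_line sp) (sections_form sp EX) (proj_compl sp' EX).
rewrite scale0r !bracket0l !(proj0 sp) !addr0 (proj_id sp EX) 2!dformE.
rewrite (proj_metric sp) // -!dformE dH (dform_proj _ EX').
by ring.
Qed.

Lemma nabla_dform_section W X X' : sections E X -> sections E X' ->
  nabla_dform W X X' = 0.
Proof.
have dform0 Z Z' : sections E Z -> sections E Z' -> dform eta Z Z' = 0.
  move=> EZ EZ'; rewrite dformE (sections_orth sp) //; exact: (sections_phi sp).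
move=> EX EX'; rewrite /nabla_dform !dform0 ?vder0 ?subr0 //.
  exact: nabla_section.
exact: nabla_section.
Qed.

End OneSide.

Section Parallel.
Context {E F : distribution M} (sp : contact_splitting phi xi eta g E F).
Context (bl : biLegendrian_connection eta xi E F nabla).
Let contactM := split_contact sp.
Let reeb : is_reeb eta xi. Proof. by case: contactM. Qed.
Let dformE := contact_dformE contactM.
Let sp' := contact_splittingC sp.
Let bl' := biLegendrianC bl.
Let conn : is_connection nabla. Proof. by case: bl. Qed.

Local Notation prE := (proj E (dsum F (dline xi))).
Local Notation prF := (proj F (dsum E (dline xi))).

(** [nabla (d eta) = 0]. Within [E] and within [F] both sides vanish. On mixed
    pairs the directions of [E] and of [F] are the two dualities that define the
    connection, and the direction of [xi] is [L_xi (d eta) = 0]. *)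
Lemma nabla_dform_eq0 W V V' : nabla_dform W V V' = 0.
Proof.
have xi0 U W' : nabla_dform W' xi U = 0.
  rewrite /nabla_dform (nabla_xi bl) (dform0l contactM).
  by rewrite !(contact_dform_xi contactM) vder0; ring.
have EF X Y W' : sections E X -> sections F Y -> nabla_dform W' X Y = 0.
  move=> EX FY; move: W'; apply: (split_ind sp) => [f U U' U0 U'0|X'|Y'|] .
  - by rewrite (nabla_dform_linl conn contactM) U0 U'0; ring.
  - move=> EX'; rewrite /nabla_dform (nabla_dform_along sp bl EX' EX FY).
    rewrite (nabla_bracket sp' bl' FY (proj_compl sp' EX')); ring.
  - move=> FY'; rewrite (nabla_dformC _ X) /nabla_dform.
    rewrite (nabla_dform_along sp' bl' FY' FY EX).
    rewrite (nabla_bracket sp bl EX (proj_compl sp FY')); ring.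
  rewrite /nabla_dform (reeb_lie_dform reeb).
  rewrite (nabla_bracket sp bl EX (proj_xi sp)).
  rewrite (nabla_bracket sp' bl' FY (proj_xi sp')).
  rewrite (dform_proj sp _ EX) (dformC _ (prE _)) (dform_proj sp' _ FY).
  by rewrite (dformC _ Y); ring.
move: V V' W; apply: (split_ind sp) => [f U V U0 V0 V' W|X EX|Y FY|V' W].
- by rewrite (nabla_dform_lin conn contactM) U0 V0; ring.
- apply: (split_ind sp) => [f U V U0 V0 W|X' EX' W|Y FY W|W].
  + rewrite (nabla_dformC W X) (nabla_dform_lin conn contactM).
    by rewrite (nabla_dformC W U) (nabla_dformC W V) U0 V0; ring.
  + exact: (nabla_dform_section sp bl).
  + exact: EF.
  + by rewrite nabla_dformC xi0 oppr0.
- apply: (split_ind sp) => [f U V U0 V0 W|X EX W|Y' FY' W|W].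
  + rewrite (nabla_dformC W Y) (nabla_dform_lin conn contactM).
    by rewrite (nabla_dformC W U) (nabla_dformC W V) U0 V0; ring.
  + by rewrite nabla_dformC EF // oppr0.
  + exact: (nabla_dform_section sp' bl').
  + by rewrite nabla_dformC xi0 oppr0.
- exact: xi0.
Qed.

Lemma vder_form W V : vder W (app_form eta V) = app_form eta (nabla W V).
Proof.
move: V; apply: (split_ind sp) => [f U U' IH IH'|X EX|Y FY|].
- rewrite (nablaDr conn) (nablaZr conn) !app_formE vderD vderM IH IH'; ring.
- by rewrite !(sections_form sp) ?vder0 //; exact: (nabla_section sp bl).
- by rewrite !(sections_form sp') ?vder0 //; exact: (nabla_section sp' bl').
- rewrite (nabla_xi bl) (contact_form_xi contactM) vder1 -(scale0r 0).
  by rewrite app_formZ mul0r.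
Qed.

Lemma vder_dform W V V' : vder W (dform eta V V') =
  dform eta (nabla W V) V' + dform eta V (nabla W V').
Proof.
have /eqP := nabla_dform_eq0 W V V'.
by rewrite /nabla_dform -addrA -opprD subr_eq0 => /eqP.
Qed.

(** * Parallelism of [g] and of [phi] *)

(** Since [eta] and [d eta] are parallel, this formula makes the parallelism of
    [phi] pass to [g]. *)
Lemma metric_dform V V' : app_metric g V V' =
  app_form eta V * app_form eta V' - dform eta V (app_endo phi V').
Proof.
rewrite dformE (contact_phi2 contactM) app_metricDr app_metricNr app_metricZr.
rewrite (contact_metric_xi contactM); ring.
Qed.

(** Conversely, [d eta = g (., phi .)] with [d eta] and [g] parallel, and [g] is
    nondegenerate. *)
Lemma parallel_metric_endo : parallel_metric nabla g -> parallel_endo nabla phi.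
Proof.
move=> pg W V; apply: (@app_metric_inj _ _ _ g) => Z.
rewrite app_metricC (app_metricC _ _ Z).
apply: (addrI (app_metric g (nabla W Z) (app_endo phi V))).
by rewrite -pg -!dformE vder_dform.
Qed.

Lemma parallel_endo_metric : parallel_endo nabla phi -> parallel_metric nabla g.
Proof.
move=> pphi W V V'; rewrite !metric_dform vderD vderN vderM vder_dform.
rewrite !vder_form pphi; ring.
Qed.

(** [nabla_X X' = - nabla_X (phi (phi X')) = - phi (nabla_X (phi X'))], and the
    last derivative is a bracket, as [phi X'] lies in the other summand. *)
Lemma parallel_endo_formula X X' : parallel_endo nabla phi ->
  sections E X -> sections E X' ->
  nabla X X' = - prE (app_endo phi (bracket X (app_endo phi X'))).
Proof.
move=> pphi EX EX'; have FphiX' := sections_phi sp EX'.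
have := pphi X (app_endo phi X').
rewrite (sections_phi2 sp EX') (nablaNr conn).
rewrite (nabla_bracket sp' bl' FphiX' (proj_compl sp' EX)) -(proj_phi sp) => <-.
by rewrite opprK.
Qed.

(** The derivatives along [xi] are projected brackets, so the [F] component of
    [h X] measures the failure of [phi] to be parallel along [xi]. *)
Lemma proj_tensor_h X : sections E X ->
  prF (tensor_h phi xi X) =
  cstf 2^-1 *: (nabla xi (app_endo phi X) - app_endo phi (nabla xi X)).
Proof.
move=> EX; have FphiX := sections_phi sp EX.
rewrite /tensor_h (projZ sp') (projD sp') (projN sp').
rewrite (nabla_bracket sp bl EX (proj_xi sp)).
by rewrite (nabla_bracket sp' bl' FphiX (proj_xi sp')) (proj_phi sp').
Qed.

Lemma form_tensor_h X : sections E X -> app_form eta (tensor_h phi xi X) = 0.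
Proof.
move=> EX; rewrite /tensor_h app_formZ app_formD app_formN.
rewrite (reeb_form_bracket reeb).
by rewrite !(contact_form_phi contactM) vder0; ring.
Qed.

Lemma parallel_endo_tensor_h : parallel_endo nabla phi ->
  preserves (tensor_h phi xi) E.
Proof.
move=> pphi X EX; rewrite (proj_dec sp (tensor_h phi xi X)).
rewrite proj_tensor_h // form_tensor_h // pphi subrr scaler0 scale0r !addr0.
exact: (proj_section sp).
Qed.

(** * Bundle-like metrics *)

(** Parallelism of [d eta] on the pair [X, phi X'] reads
    [W (g (X, X')) = g (nabla_W X, X') + g (phi X, nabla_W (phi X'))].
    Adding the same with [X] and [X'] exchanged, and using that [phi] is an
    isometry on [E], gives the claim. *)
Lemma nabla_metric_phi W X X' : sections E X -> sections E X' ->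
  nabla_metric W (app_endo phi X) (app_endo phi X') = - nabla_metric W X X'.
Proof.
have half Z Z' : sections E Z -> sections E Z' ->
    vder W (app_metric g Z Z') = app_metric g (nabla W Z) Z' +
      app_metric g (app_endo phi Z) (nabla W (app_endo phi Z')).
  move=> EZ EZ'; have := vder_dform W Z (app_endo phi Z').
  rewrite !dformE (sections_phi2 sp EZ') !app_metricNr vderN.
  rewrite (metric_phi_skew contactM).
  by move=> /(congr1 (fun f => - f)); rewrite opprK => ->; ring.
move=> EX EX'; rewrite /nabla_metric (metric_phi contactM).
rewrite (sections_form sp EX) mul0r subr0.
have h1 := half X X' EX EX'; have h2 := half X' X EX' EX.
rewrite (app_metricC _ X' X) in h2.
rewrite (app_metricC _ X (nabla W X')).
rewrite (app_metricC _ (nabla W (app_endo phi X))).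
have -> : app_metric g (app_endo phi X') (nabla W (app_endo phi X)) =
  vder W (app_metric g X X') - app_metric g (nabla W X') X by rewrite h2; ring.
have -> : app_metric g (app_endo phi X) (nabla W (app_endo phi X')) =
  vder W (app_metric g X X') - app_metric g (nabla W X) X' by rewrite {1}h1; ring.
ring.
Qed.

(** In directions of [E] and [xi] the connection acts on sections of [F] as the
    projected bracket, and [g] does not see the rest of the bracket. *)
Lemma lie_nabla_metric V Y Y' : sections (dsum E (dline xi)) V ->
  sections F Y -> sections F Y' -> lie_metric g V Y Y' = nabla_metric V Y Y'.
Proof.
move=> EV FY FY'; have FV : prF V = 0.
  rewrite (sections_dsum_xiP sp EV) (projD sp') (projZ sp') (proj_xi sp').
  by rewrite (proj_compl sp' (proj_section sp V)) scaler0 addr0.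
rewrite /lie_metric /nabla_metric !(nabla_bracket sp' bl') //.
by rewrite !(app_metricC _ Y) !(proj_metric sp').
Qed.

Lemma parallel_metric_bundle_like : parallel_metric nabla g ->
  bundle_like g (dsum E (dline xi)).
Proof.
move=> /parallel_metricP pg V Z Z' EV.
move=> /(sections_dorthP sp) FZ /(sections_dorthP sp) FZ'.
by rewrite lie_nabla_metric.
Qed.

End Parallel.

(** * The converse implications *)

Definition nabla_formula E F : Prop :=
  forall X X', sections E X -> sections E X' ->
    nabla X X' =
      - proj E (dsum F (dline xi)) (app_endo phi (bracket X (app_endo phi X'))).

Section Converse.
Context {E F : distribution M} (sp : contact_splitting phi xi eta g E F).
Context (bl : biLegendrian_connection eta xi E F nabla).
Let contactM := split_contact sp.
Let sp' := contact_splittingC sp.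
Let bl' := biLegendrianC bl.
Let conn : is_connection nabla. Proof. by case: bl. Qed.

Local Notation prE := (proj E (dsum F (dline xi))).
Local Notation prF := (proj F (dsum E (dline xi))).

(** One direction at a time: along [E] by the formula on [E], along [F] by the
    formula on [F], whose section [phi X] is, and along [xi] by the condition on
    [h]. *)
Lemma formula_parallel_on W X : nabla_formula E F -> nabla_formula F E ->
  preserves (tensor_h phi xi) E -> sections E X ->
  nabla W (app_endo phi X) = app_endo phi (nabla W X).
Proof.
move=> fE fF hE EX; have FphiX := sections_phi sp EX.
move: W; apply: (split_ind sp) => [f U V IHU IHV|X'|Y|] .
- by rewrite !(nablaDl conn) !(nablaZl conn) IHU IHV app_endoD app_endoZ.
- move=> EX'; rewrite (fE _ _ EX' EX).
  rewrite (nabla_bracket sp' bl' FphiX (proj_compl sp' EX')).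
  rewrite app_endoN -(proj_phi sp') (contact_phi2 contactM).
  rewrite (projD sp') (projN sp').
  by rewrite (projZ sp') (proj_xi sp') scaler0 addr0 opprK.
- move=> FY; rewrite (fF _ _ FY FphiX) (sections_phi2 sp EX).
  rewrite bracketNr app_endoN (projN sp') opprK.
  by rewrite (nabla_bracket sp bl EX (proj_compl sp FY)) (proj_phi sp').
have := proj_tensor_h sp bl EX; rewrite (proj_compl sp' (hE _ EX)).
move=> /(congr1 (fun V => V + V)); rewrite addr0 -scalerDr.
set D := nabla _ _ - _ => hD; apply/eqP; rewrite -subr_eq0 -/D.
apply/eqP; rewrite hD; apply: vfield_eqP => f.
by rewrite vderZv (vderDv D D) half_double.
Qed.

(** The mixed terms vanish because [nabla] preserves the three orthogonal
    summands. *)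
Lemma tensorial_nabla_metric W V V' :
  (forall X X', sections E X -> sections E X' -> nabla_metric W X X' = 0) ->
  (forall Y Y', sections F Y -> sections F Y' -> nabla_metric W Y Y' = 0) ->
  nabla_metric W V V' = 0.
Proof.
move=> gE gF.
have xi0 U : nabla_metric W U xi = 0.
  rewrite /nabla_metric (nabla_xi bl) app_metric0r !(contact_metric_xi contactM).
  by rewrite (vder_form sp bl); ring.
have gEF X Y : sections E X -> sections F Y ->
    nabla_metric W X Y = 0.
  move=> EX FY; rewrite /nabla_metric (sections_orth sp EX FY).
  rewrite (sections_orth sp (nabla_section sp bl _ EX) FY).
  by rewrite (sections_orth sp EX (nabla_section sp' bl' _ FY)) vder0; ring.
move: V V'; apply: (split_ind sp) => [f U V U0 V0 V'|X EX|Y FY|V'].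
- by rewrite (nabla_metric_lin conn) U0 V0; ring.
- apply: (split_ind sp) => [f U V U0 V0|X' EX'|Y FY|].
  + rewrite nabla_metricC (nabla_metric_lin conn).
    by rewrite !(nabla_metricC W _ X) U0 V0; ring.
  + exact: gE.
  + exact: gEF.
  + exact: xi0.
- apply: (split_ind sp) => [f U V U0 V0|X EX|Y' FY'|].
  + rewrite nabla_metricC (nabla_metric_lin conn).
    by rewrite !(nabla_metricC W _ Y) U0 V0; ring.
  + by rewrite nabla_metricC gEF.
  + exact: gF.
  + exact: xi0.
by rewrite nabla_metricC xi0.
Qed.

(** In the directions of [E] and [xi], bundle-likeness gives [nabla g = 0] on
    [F] as a Lie derivative, and then on [E] through [phi]. *)
Lemma bundle_like_nabla_metric V : bundle_like g (dsum E (dline xi)) ->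
  sections (dsum E (dline xi)) V ->
  (forall Y Y', sections F Y -> sections F Y' ->
    nabla_metric V Y Y' = 0) /\
  (forall X X', sections E X -> sections E X' ->
    nabla_metric V X X' = 0).
Proof.
move=> blE EV; have gF Y Y' : sections F Y -> sections F Y' ->
    nabla_metric V Y Y' = 0.
  move=> FY FY'; rewrite -(lie_nabla_metric sp bl) //.
  by apply: blE => //; apply/(sections_dorthP sp).
split=> // X X' EX EX'; apply/eqP; rewrite -oppr_eq0 -(nabla_metric_phi sp bl) //.
by rewrite gF //; exact: (sections_phi sp).
Qed.

End Converse.

Section Equivalence.
Context {E F : distribution M} (sp : contact_splitting phi xi eta g E F).
Context (bl : biLegendrian_connection eta xi E F nabla).
Let contactM := split_contact sp.
Let sp' := contact_splittingC sp.
Let bl' := biLegendrianC bl.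
Let conn : is_connection nabla. Proof. by case: bl. Qed.

Lemma formula_parallel_endo : nabla_formula E F -> nabla_formula F E ->
  preserves (tensor_h phi xi) E -> preserves (tensor_h phi xi) F ->
  parallel_endo nabla phi.
Proof.
move=> fE fF hE hF W; apply: (split_ind sp) => [f U V IHU IHV|X EX|Y FY|].
- rewrite app_endoD app_endoZ !(nablaDr conn) !(nablaZr conn) IHU IHV.
  by rewrite !app_endoD !app_endoZ.
- exact: (formula_parallel_on sp bl).
- exact: (formula_parallel_on sp' bl').
have nabla0 : nabla W 0 = 0.
  by rewrite -{1}(scale0r 0) (nablaZr conn) vder0 !scale0r addr0.
have phi0 : app_endo phi 0 = 0 by rewrite -{1}(scale0r 0) app_endoZ scale0r.
by rewrite (contact_phi_xi contactM) (nabla_xi bl) nabla0 phi0.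
Qed.

Lemma bundle_like_parallel_metric : bundle_like g (dsum E (dline xi)) ->
  bundle_like g (dsum F (dline xi)) -> parallel_metric nabla g.
Proof.
move=> blE blF; apply/parallel_metricP => W V V'.
have xiE : sections (dsum E (dline xi)) xi.
  have := sections_dsum_xi (xi := xi) 1 (sections0 sp).
  by rewrite add0r scale1r.
have sec (G : distribution M) X : sections G X -> sections (dsum G (dline xi)) X.
  by move=> /(sections_dsum_xi (xi := xi) 0); rewrite scale0r addr0.
apply: (tensorial_nabla_metric sp bl) => {V V'}.
- move: W; apply: (split_ind sp) =>
    [f U U' IHU IHV|X /sec EX|Y /sec FY|] V V' EV EV'.
  + by rewrite (nabla_metric_linl conn) IHU // IHV //; ring.
  + exact: (bundle_like_nabla_metric sp bl blE EX).2.
  + exact: (bundle_like_nabla_metric sp' bl' blF FY).1.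
  + exact: (bundle_like_nabla_metric sp bl blE xiE).2.
- move: W; apply: (split_ind sp) =>
    [f U U' IHU IHV|X /sec EX|Y /sec FY|] V V' EV EV'.
  + by rewrite (nabla_metric_linl conn) IHU // IHV //; ring.
  + exact: (bundle_like_nabla_metric sp bl blE EX).1.
  + exact: (bundle_like_nabla_metric sp' bl' blF FY).2.
  + exact: (bundle_like_nabla_metric sp bl blE xiE).1.
Qed.

End Equivalence.
End Connection.

(** * Total geodesicity *)

Section Geodesic.
Context {R : realType} {m : nat} {M : manifold R m} {g : metric M}.
Context {D : vfield M -> vfield M -> vfield M} (lc : levi_civita g D).
Implicit Types (X Z : vfield M) (E : distribution M).

(** On a distribution to which [Z] is normal, [- L_Z g] is the [Z] component of
    twice the symmetrized second fundamental form. *)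
Lemma lie_metric_second_form Z X X' :
  app_metric g Z X = 0 -> app_metric g Z X' = 0 ->
  lie_metric g Z X X' = - (app_metric g Z (D X X') + app_metric g Z (D X' X)).
Proof.
have [_ pg tors] := lc => ZX ZX'.
have h1 : app_metric g (D X Z) X' = - app_metric g Z (D X X').
  by have := pg X Z X'; rewrite ZX' vder0 => /esym/eqP; rewrite addr_eq0 => /eqP.
have h2 : app_metric g (D X' Z) X = - app_metric g Z (D X' X).
  by have := pg X' Z X; rewrite ZX vder0 => /esym/eqP; rewrite addr_eq0 => /eqP.
rewrite /lie_metric pg -!tors !app_metricE (app_metricC _ X (D X' Z)) h1 h2.
ring.
Qed.

(** Locally [E] is cut out by the differentials of functions, and a bracket of
    two derivations that kill a function near a point kills it there. *)
Lemma integrable_bracket k E X X' : integrable k E ->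
  sections E X -> sections E X' -> sections E (bracket X X').
Proof.
move=> iE EX EX' p; have [y ny] := iE p.
have zero Z i : sections E Z -> \forall q \near p, vder Z (y i) q = 0.
  by move=> EZ; apply: filterS ny => q Eq; have := EZ q; rewrite Eq; exact.
rewrite (nbhs_singleton ny) /= => i.
rewrite (tangent_local (h := 0) _ (zero X' i EX')).
rewrite (tangent_local (h := 0) _ (zero X i EX)).
have at0 Z : Z p 0 = 0 := smoothfun_at p (vder0 Z).
by rewrite !at0 subr0.
Qed.

End Geodesic.

Section GeodesicSplitting.
Context {R : realType} {n : nat} {M : manifold R n.*2.+1}.
Context {phi : endo M} {xi : vfield M} {eta : oneform M} {g : metric M}.
Context {E F : distribution M} (sp : contact_splitting phi xi eta g E F).
Context {D : vfield M -> vfield M -> vfield M} (lc : levi_civita g D).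
Let sp' := contact_splittingC sp.

(** For [Z] orthogonal to [E], integrability makes [D_X X' - D_X' X = [X, X']]
    orthogonal to [Z], so that [(L_Z g)(X, X') = - 2 g (Z, D_X X')]. *)
Lemma totally_geodesic_bundle_like k : integrable k E ->
  totally_geodesic D E <-> bundle_like g (dsum F (dline xi)).
Proof.
move=> iE; have [_ _ tors] := lc.
have orth Z X : sections (dsum F (dline xi)) Z -> sections E X ->
    app_metric g Z X = 0.
  move=> FZ EX; rewrite app_metricC; apply: smoothfun_ext => p.
  by apply: (split_orth_xi sp); [exact: EX|exact: FZ].
split=> [tg Z X X' FZ /(sections_dorthP sp') EX /(sections_dorthP sp') EX'|ble].
  rewrite (lie_metric_second_form lc) ?orth //; first by ring.
    by apply: tg.
  by apply: tg.
move=> X X' EX EX'; have := proj_dec sp (D X X').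
set X1 := proj E _ _; rewrite -addrA; set Z := proj F _ _ + _ => DE.
have EX1 : sections E X1 by exact: (proj_section sp).
have FZ : sections (dsum F (dline xi)) Z.
  by apply: sections_dsum_xi; exact: (proj_section sp').
have sym : app_metric g Z (D X' X) = app_metric g Z (D X X').
  apply/eqP; rewrite -subr_eq0 -app_metricNr -app_metricDr tors.
  by rewrite orth //; exact: (integrable_bracket iE).
have oE U : sections E U -> sections (dorth g (dsum F (dline xi))) U.
  by move=> EU; apply/(sections_dorthP sp').
have := ble Z X X' FZ (oE _ EX) (oE _ EX').
rewrite (lie_metric_second_form lc (orth _ _ FZ EX) (orth _ _ FZ EX')).
rewrite sym => /eqP; rewrite oppr_eq0 => /eqP.
move=> /(congr1 ( *%R (cstf 2^-1))); rewrite half_double mulr0.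
rewrite DE app_metricDr orth // add0r => /app_metric_eq0 Z0.
by rewrite Z0 addr0.
Qed.

End GeodesicSplitting.

(** * The equivalences *)

Theorem proposition2p9 (R : realType) (n : nat) (M : manifold R n.*2.+1)
    (phi : endo M) (xi : vfield M) (eta : oneform M) (g : metric M)
    (L : distribution M) (nabla : vfield M -> vfield M -> vfield M) :
  contact_metric phi xi eta g ->
  legendrian eta L ->
  let Q := dimage phi L in
  biLegendrian_connection eta xi L Q nabla ->
  [<-> (* (i) *) parallel_metric nabla g;
       (* (ii) *) parallel_endo nabla phi;
       (* (iii) *)
       [/\ forall X X', sections L X -> sections L X' ->
             nabla X X' = - proj L (dsum Q (dline xi))
                              (app_endo phi (bracket X (app_endo phi X'))),
           forall Y Y', sections Q Y -> sections Q Y' ->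
             nabla Y Y' = - proj Q (dsum L (dline xi))
                              (app_endo phi (bracket Y (app_endo phi Y'))),
           preserves (tensor_h phi xi) L &
           preserves (tensor_h phi xi) Q];
       (* (iv) *)
       bundle_like g (dsum L (dline xi)) /\ bundle_like g (dsum Q (dline xi))]
  /\
  (integrable n.+1 L -> integrable n.+1 Q ->
   forall nablag : vfield M -> vfield M -> vfield M, levi_civita g nablag ->
     (parallel_metric nabla g <->
      totally_geodesic nablag L /\ totally_geodesic nablag Q)).
Proof.
move=> contactM legL Q bl.
have sp := legendrian_splitting contactM legL.
have sp' := contact_splittingC sp; have bl' := biLegendrianC bl.
have i_iv : parallel_metric nabla g ->
    bundle_like g (dsum L (dline xi)) /\ bundle_like g (dsum Q (dline xi)).
  move=> pg; split; first exact: (parallel_metric_bundle_like sp bl).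
  exact: (parallel_metric_bundle_like sp' bl').
have iv_i :
    bundle_like g (dsum L (dline xi)) /\ bundle_like g (dsum Q (dline xi)) ->
    parallel_metric nabla g.
  by case=> blL blQ; exact: (bundle_like_parallel_metric sp bl).
split.
  tfae.
  - exact: (parallel_metric_endo sp bl).
  - move=> pphi; split.
    + by move=> X X'; exact: (parallel_endo_formula sp bl).
    + by move=> Y Y'; exact: (parallel_endo_formula sp' bl').
    + exact: (parallel_endo_tensor_h sp bl).
    + exact: (parallel_endo_tensor_h sp' bl').
  (* (iii) to (iv) passes through (ii) and (i). *)
  - case=> fL fQ hL hQ; apply: i_iv; apply: (parallel_endo_metric sp bl).
    exact: (formula_parallel_endo sp bl).
  - exact: iv_i.
move=> intL intQ D lc.
have geoL := totally_geodesic_bundle_like sp lc intL.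
have geoQ := totally_geodesic_bundle_like sp' lc intQ.
split=> [/i_iv [blL blQ]|[tgL tgQ]]; first by split; [apply/geoL|apply/geoQ].
by apply: iv_i; split; [apply/geoQ|apply/geoL].
Qed.
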